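(* For every $\mathrm{SU}(4)$-invariant metric affine connection $\nabla$ on $\mathbb{S}^7$ there are $q_1,q_2\in\mathbb{C}$ and $t\in\mathbb{R}$ such that $$\begin{aligned}\nabla_XY=\ &\nabla^g_XY+(\mathrm{Re}(q_1)-1)\big(\Phi_1(X,Y)\,\xi_1+\eta_1(Y)\psi_1(X)\big)+\mathrm{Im}(q_1)(\nabla^g_X\psi_1)(Y)\\&+\Big(t+\frac13\Big)\eta_1(X)\psi_1(Y)-\mathrm{Re}(q_2)\Theta(X,Y)+\mathrm{Im}(q_2)\widetilde\Theta(X,Y)\end{aligned}$$ for all $X,Y\in\mathfrak{X}(\mathbb{S}^7)$. Moreover, such a $\nabla$ has totally skew-symmetric torsion if and only if there are $r\in\mathbb{R}$ and $q\in\mathbb{C}$ such that $$\nabla_XY=\nabla^g_XY+r\big(\Phi_1(X,Y)\,\xi_1-\eta_1(X)\psi_1(Y)+\eta_1(Y)\psi_1(X)\big)+\mathrm{Re}(q)\Theta(X,Y)+\mathrm{Im}(q)\widetilde\Theta(X,Y)$$ for all $X,Y\in\mathfrak{X}(\mathbb{S}^7)$.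
   Context: $\mathrm{SU}(4)$ acts on the unit sphere $\mathbb{S}^7\subset\mathbb{C}^4$ by matrix multiplication; write $\tau_\sigma(p)=\sigma p$. For a vector field $X$, $\tau_\sigma(X)_p=(\tau_\sigma)_*(X_{\sigma^{-1}p})$. An affine connection $\nabla$ is $\mathrm{SU}(4)$-invariant if $\tau_\sigma(\nabla_XY)=\nabla_{\tau_\sigma(X)}\tau_\sigma(Y)$ for all $\sigma\in\mathrm{SU}(4)$ and all vector fields $X,Y$. $g$ is the canonical Riemannian metric of constant sectional curvature $1$ and $\nabla^g$ its Levi-Civita connection. $\nabla$ is metric if $\nabla g=0$ (its torsion need not vanish). Its torsion is $T^\nabla(X,Y)=\nabla_XY-\nabla_YX-[X,Y]$, and $\nabla$ has totally skew-symmetric torsion if $\omega_\nabla(X,Y,Z)=g(T^\nabla(X,Y),Z)$ is a $3$-form. 3-Sasakian structure: identify $\mathbb{C}^4\cong\mathbb{H}^2$ by $(z_1,z_2,z_3,z_4)\mapsto(z_1+z_2\mathbf{j},z_3+z_4\mathbf{j})$, and let $\mathbf{i},\mathbf{j},\mathbf{k}$ act by left multiplication. With $N$ the unit outward normal, set $\xi_1(z)=-\mathbf{i}z$, $\xi_2(z)=-\mathbf{j}z$, $\xi_3(z)=-\mathbf{k}z$, and define $(1,1)$-tensors $\psi_s$ and $1$-forms $\eta_s$ by the decompositions into tangent and normal parts $\mathbf{i}X=\psi_1(X)+\eta_1(X)N$, $\mathbf{j}X=\psi_2(X)+\eta_2(X)N$, $\mathbf{k}X=\psi_3(X)+\eta_3(X)N$.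 Put $\Phi_s(X,Y)=g(X,\psi_s(Y))$, so $d\eta_s=2\Phi_s$. Let $\Omega=\frac12(\eta_2\wedge d\eta_2-\eta_3\wedge d\eta_3)=\eta_2\wedge\Phi_2-\eta_3\wedge\Phi_3$ (where $\eta\wedge\Phi$ evaluated on $(X,Y,Z)$ is the cyclic sum of $\eta(X)\Phi(Y,Z)$). The tensors $\Theta,\widetilde\Theta$ are defined by $g(\Theta(X,Y),Z)=\Omega(X,Y,Z)$ and $g(\widetilde\Theta(X,Y),Z)=\Omega(X,Y,\psi_1(Z))$ for all vector fields $X,Y,Z$. *)

(* Defs.v *)
From HB Require Import structures.
From mathcomp Require Import all_boot all_order all_algebra.
From mathcomp Require Import complex spectral.
From mathcomp Require Import all_classical all_reals all_analysis.
From mathcomp Require Import ring.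
Set Implicit Arguments.
Unset Strict Implicit.
Unset Printing Implicit Defensive.
Import Order.TTheory GRing.Theory Num.Theory.
Import numFieldNormedType.Exports.
Local Open Scope classical_set_scope.
Local Open Scope complex_scope.
Local Open Scope sesquilinear_scope.
Local Open Scope ring_scope.

(* C^4 is carried by its real coordinates: row a of a 4 x 2 real matrix is
   (Re z_a, Im z_a), so that C^4 is a normed space over the reals. *)
Notation C4 R := ('M[R]_(4, 2)).

Section RealLinear.
Context {R : realType}.

Definition toC (x : C4 R) : 'cV[R[i]]_4 := \col_a (x a 0 +i* x a 1).
Definition ofC (z : 'cV[R[i]]_4) : C4 R :=
  \matrix_(a, b) (if b == 0 then complex.Re (z a 0) else complex.Im (z a 0)).

(* real part of the Hermitian product (innerE below); its restriction to the
   tangent spaces of the unit sphere is the metric of curvature 1 *)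
Definition inner (x y : C4 R) : R := \sum_a \sum_b x a b * y a b.

(* the pair (a, b) stands for the quaternion a + b j, hence
   (a + b j)(c + d j) = (a c - b d^* ) + (a d + b c^* ) j *)
Definition quat := (R[i] * R[i])%type.
Definition qmul (q h : quat) : quat :=
  (q.1 * h.1 - q.2 * (h.2)^*, q.1 * h.2 + q.2 * (h.1)^*).
Definition qi : quat := ('i%C, 0).
Definition qj : quat := (0, 1).
Definition qk : quat := (0, 'i%C).

(* left multiplication by q on C^4 = H^2,
   (z1, z2, z3, z4) <-> (z1 + z2 j, z3 + z4 j) *)
Definition lmulq (q : quat) (x : C4 R) : C4 R :=
  let z := toC x in
  let h1 := qmul q (z 0 0, z 1 0) in
  let h2 := qmul q (z 2 0, z 3 0) in
  ofC (\col_(a < 4) [:: h1.1; h1.2; h2.1; h2.2]`_a).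

Lemma sum2E (F : 'I_2 -> R) : \sum_b F b = F 0 + F 1.
Proof. by rewrite !big_ord_recl big_ord0 addr0; congr (_ + F _); apply/val_inj. Qed.

Lemma I2P (b : 'I_2) : b = 0 \/ b = 1.
Proof. by case: b => [[|[|//]] Hb]; [left|right]; apply/val_inj. Qed.

Lemma toC_lin (c : R) x y : toC (c *: x + y) = c%:C *: toC x + toC y.
Proof.
apply/matrixP => a b; rewrite !mxE; apply/eqP; rewrite eq_complex /=.
by rewrite !mul0r subr0 addr0 !eqxx.
Qed.

Lemma ofC_lin (c : R) x y : ofC (c%:C *: x + y) = c *: ofC x + ofC y.
Proof.
apply/matrixP => a b; rewrite !mxE.
by case: (x a 0) (y a 0) => [? ?] [? ?]; case: ifP => _ /=;
  rewrite mul0r ?subr0 ?addr0.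
Qed.

Lemma toCK : cancel toC ofC.
Proof.
by move=> x; apply/matrixP => a b; rewrite !mxE; case: (I2P b) => ->.
Qed.

Lemma ofCK : cancel ofC toC.
Proof.
by move=> x; apply/matrixP => a b; rewrite !mxE /= (ord1 b); case: (x a 0).
Qed.

Lemma innerC x y : inner x y = inner y x.
Proof. by apply: eq_bigr => a _; apply: eq_bigr => b _; rewrite mulrC. Qed.

Lemma innerDl x y z : inner (x + y) z = inner x z + inner y z.
Proof.
rewrite /inner -big_split; apply: eq_bigr => a _ /=.
by rewrite -big_split; apply: eq_bigr => b _ /=; rewrite mxE mulrDl.
Qed.

Lemma innerZl c x z : inner (c *: x) z = c * inner x z.
Proof.
rewrite /inner mulr_sumr; apply: eq_bigr => a _ /=.
by rewrite mulr_sumr; apply: eq_bigr => b _ /=; rewrite mxE mulrA.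
Qed.

Lemma innerDr x y z : inner z (x + y) = inner z x + inner z y.
Proof. by rewrite innerC innerDl !(innerC z). Qed.

Lemma innerZr c x z : inner z (c *: x) = c * inner z x.
Proof. by rewrite innerC innerZl innerC. Qed.

Lemma innerE x y : inner x y = complex.Re (((toC x)^t* *m toC y) 0 0).
Proof.
rewrite mxE /inner raddf_sum /=; apply: eq_bigr => a _.
by rewrite !mxE sum2E /= mulNr opprK.
Qed.

Lemma lmulq_linear q : linear (lmulq q).
Proof.
move=> c x y; rewrite /lmulq -ofC_lin toC_lin; congr ofC.
apply/matrixP => a b; rewrite !mxE.
have conjl (u v : R[i]) : (c%:C * u + v)^* = c%:C * u^* + v^*.
  by rewrite rmorphD rmorphM; congr (_ * _ + _); exact: (@conjc_real R).
case: q => q1 q2.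
by case: a => [[|[|[|[|//]]]] Ha] /=; rewrite conjl; ring.
Qed.
HB.instance Definition _ q :=
  GRing.isLinear.Build R (C4 R) (C4 R) _ (lmulq q) (lmulq_linear q).

End RealLinear.
Arguments quat R : clear implicits.

Section Sphere.
Context {R : realType}.

Record S7 := MkS7 { pt : C4 R ; pt_unit : inner pt pt == 1 }.
HB.instance Definition _ := [isSub for pt].

Lemma S7_norm (p : S7) : inner (pt p) (pt p) = 1.
Proof. exact/eqP/pt_unit. Qed.

Fixpoint Ck (n : nat) (U : set (C4 R)) (F : C4 R -> R) : Prop :=
  match n with
  | 0 => forall x, U x -> {for x, continuous F}
  | n.+1 => (forall x, U x -> differentiable F x) /\
            forall v, Ck n U (fun x => 'D_v F x)
  end.

(* near every point of the sphere, f is the restriction of a C^oo function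
   on an open set of C^4 *)
Definition smooth (f : S7 -> R) : Prop :=
  forall p, exists (U : set (C4 R)) (F : C4 R -> R),
    [/\ open U, U (pt p), (forall n, Ck n U F) &
        forall q, U (pt q) -> f q = F (pt q)].

(* derivative of f at p in the tangent direction v, computed along the curve
   t |-> (p + t v) / |p + t v| of the sphere; the default value p of insubd is
   never used, since p + t v <> 0 for v tangent at p *)
Definition dirder (f : S7 -> R) (p : S7) (v : C4 R) : R :=
  derive1 (fun t : R =>
     let x := pt p + t *: v in
     f (insubd p ((Num.sqrt (inner x x))^-1 *: x))) 0.

Record sfun := MkSfun { sfval :> S7 -> R ; sf_smooth : smooth sfval }.

Record vfield := MkVfield {
  vfval :> S7 -> C4 R ;
  vf_tangent : forall p, inner (vfval p) (pt p) = 0 ;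
  vf_smooth : forall a b, smooth (fun p => vfval p a b) }.

Lemma CkS n U F : Ck n.+1 U F -> Ck n U F.
Proof.
elim: n F => [|n IH] F /= [dF DF].
  by move=> x Ux; apply: differentiable_continuous; exact: dF.
by split=> // v; apply: IH; exact: DF.
Qed.


Lemma differentiable_near (F G : C4 R -> R) x :
  (\near x, F x = G x) -> differentiable F x -> differentiable G x.
Proof.
move=> FG dF; have [cdF eF] := (diff_locallyP x F).1 dF.
have eG : G \o shift x = cst (G x) + 'd F x +o_ 0 id.
  apply/eqaddoP => e e0.
  have /eqaddoP /(_ e e0) H := eF.
  have FG' : \forall y \near (0 : C4 R), F (shift x y) = G (shift x y).
    by move: FG; rewrite (near_shift 0) subr0.
  near=> y.
  have -> : (G \o shift x - (cst (G x) + 'd F x)) y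
         = (F \o shift x - (cst (F x) + 'd F x)) y.
    rewrite /= (nbhs_singleton FG); congr (_ - _).
    by symmetry; near: y.
  by near: y.
by apply/diff_locallyP; rewrite (diff_unique cdF eG).
Unshelve. all: by end_near. Qed.

Lemma Ck_ext n U F G : open U -> (forall x, U x -> F x = G x) ->
  Ck n U F -> Ck n U G.
Proof.
move=> oU; have nE (H K : C4 R -> R) x : U x ->
    (forall y, U y -> H y = K y) -> \near x, H x = K x.
  by move=> Ux HK; near=> y; apply: HK; near: y; exact: open_nbhs_nbhs.
elim: n F G => [|n IH] F G FG /=.
  move=> cF x Ux; rewrite /prop_for /continuous_at -FG //.
  by apply: cvg_trans (cF x Ux); apply: (@near_eq_cvg _ _ (nbhs x)); exact: nE.
move=> [dF DF]; split.
  by move=> x Ux; apply: differentiable_near (dF x Ux); exact: nE.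
by move=> v; apply: IH (DF v) => x Ux; apply: near_eq_derive; exact: nE.
Unshelve. all: by end_near. Qed.

Lemma Ck_sub n U V F : V `<=` U -> Ck n U F -> Ck n V F.
Proof.
move=> VU; elim: n F => [|n IH] F /=; first by move=> cF x /VU; exact: cF.
move=> [dF DF]; split; first by move=> x /VU; exact: dF.
by move=> v; apply: IH.
Qed.

Lemma CkD n U F G : open U -> Ck n U F -> Ck n U G -> Ck n U (F \+ G).
Proof.
move=> oU; elim: n F G => [|n IH] F G /=.
  by move=> cF cG x Ux; apply: continuousD; [exact: cF|exact: cG].
move=> [dF DF] [dG DG]; split.
  by move=> x Ux; apply: differentiableD; [exact: dF|exact: dG].
move=> v; apply: Ck_ext (IH _ _ (DF v) (DG v)) => // x Ux.
by rewrite /= deriveD //; apply: diff_derivable; [exact: dF|exact: dG].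
Qed.

Lemma CkM n U F G : open U -> Ck n U F -> Ck n U G -> Ck n U (F \* G).
Proof.
move=> oU; elim: n F G => [|n IH] F G.
  by move=> cF cG x Ux; apply: continuousM; [exact: cF|exact: cG].
move=> HF HG; have [F1 G1] := (CkS HF, CkS HG).
case: HF => dF DF; case: HG => dG DG; split.
  by move=> x Ux; apply: differentiableM; [exact: dF|exact: dG].
move=> v; apply: (Ck_ext oU _ (CkD oU (IH _ _ F1 (DG v)) (IH _ _ G1 (DF v)))).
move=> x Ux; rewrite [RHS]deriveM //; apply: diff_derivable; [exact: dF|exact: dG].
Qed.

Lemma Ck_cst n U c : Ck n U (cst c : C4 R -> R).
Proof.
elim: n c => [|n IH] c /=; first by move=> x _; exact: cst_continuous.
split=> [x _|v]; first exact: differentiable_cst.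
suff -> : (fun x : C4 R => 'D_v (cst c : C4 R -> R) x) = cst 0 by [].
by apply/funext => x; exact: derive_cst.
Qed.


Lemma mx_linear_continuous (L : {linear C4 R -> C4 R}) : continuous L.
Proof.
have -> : L = (fun y => \sum_a \sum_b y a b *: L (delta_mx a b)) :> (_ -> _).
  apply/funext => y; rewrite {1}(matrix_sum_delta y) linear_sum.
  apply: eq_bigr => a _.
  by rewrite linear_sum; apply: eq_bigr => b _; rewrite linearZ.
apply: continuous_big => [|a _]; first exact: add_continuous.
apply: continuous_big => [|b _]; first exact: add_continuous.
move=> x; apply: (@cvgZr_tmp _ _ _ (nbhs x) _ (fun y : C4 R => y a b) (x a b)).
exact: (@coord_continuous R 4 2 a b x).
Qed.

Lemma Ck_coord n U a b : Ck n U (fun x : C4 R => x a b).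
Proof.
case: n => [|n] /=; first by move=> x _; exact: coord_continuous.
split=> [x _|v]; first exact: differentiable_coord.
suff -> : (fun x : C4 R => 'D_v (fun x : C4 R => x a b) x) = cst (v a b).
  exact: Ck_cst.
apply/funext => x; apply: cvg_lim => //.
apply: cvg_near_cst; near=> h.
rewrite /= !mxE addrK /GRing.scale /= mulrA mulVf ?mul1r //.
by near: h; exact: nbhs_dnbhs_neq.
Unshelve. all: by end_near. Qed.

Lemma Ck_lin n U F (L : {linear C4 R -> C4 R}) :
  Ck n U F -> Ck n (L @^-1` U) (F \o L).
Proof.
have dL x : differentiable L x.
  by apply: linear_differentiable; exact: mx_linear_continuous.
elim: n F => [|n IH] F /=.
  move=> cF x Ux; apply: continuous_comp; last exact: cF.
  exact: mx_linear_continuous.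
move=> [dF DF]; split.
  by move=> x Ux; exact: (differentiable_comp (dL x) (dF _ Ux)).
move=> v.
suff -> : (fun x => 'D_v (F \o L) x) = (fun x => 'D_(L v) F x) \o L.
  exact: IH.
apply/funext => x; rewrite /derive /=.
by under eq_fun do rewrite linearP.
Qed.

End Sphere.

Section VectorFields.
Context {R : realType}.
Local Notation S7 := (@S7 R).
Local Notation vfield := (@vfield R).
Local Notation sfun := (@sfun R).

Lemma smooth_cst (c : R) : smooth (fun _ : S7 => c).
Proof.
by move=> p; exists setT, (cst c); split=> //; [exact: openT|move=> n; exact: Ck_cst].
Qed.

Lemma smoothD (f g : S7 -> R) : smooth f -> smooth g ->
  smooth (fun p => f p + g p).
Proof.
move=> sf sg p; have [U [F [oU Up CF fF]]] := sf p.
have [V [G [oV Vp CG gG]]] := sg p.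
have oUV : open (U `&` V) by exact: openI.
exists (U `&` V), (F \+ G); split=> // [n|q [Uq Vq]]; last by rewrite fF ?gG.
by apply: CkD => //; [apply: Ck_sub (CF n)|apply: Ck_sub (CG n)] => x [].
Qed.

Lemma smoothM (f g : S7 -> R) : smooth f -> smooth g ->
  smooth (fun p => f p * g p).
Proof.
move=> sf sg p; have [U [F [oU Up CF fF]]] := sf p.
have [V [G [oV Vp CG gG]]] := sg p.
have oUV : open (U `&` V) by exact: openI.
exists (U `&` V), (F \* G); split=> // [n|q [Uq Vq]]; last by rewrite fF ?gG.
by apply: CkM => //; [apply: Ck_sub (CF n)|apply: Ck_sub (CG n)] => x [].
Qed.

Lemma smooth_sum (I : finType) (f : I -> S7 -> R) :
  (forall i, smooth (f i)) -> smooth (fun p => \sum_i f i p).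
Proof.
move=> sf; elim: (index_enum I) => [|i r IH].
  by under eq_fun do rewrite big_nil; exact: smooth_cst.
by under eq_fun do rewrite big_cons; exact: smoothD.
Qed.

Lemma smooth_pt a b : smooth (fun p : S7 => pt p a b).
Proof.
move=> p; exists setT, (fun x => x a b); split=> //; first exact: openT.
by move=> n; exact: Ck_coord.
Qed.

Lemma smooth_inner (X Y : S7 -> C4 R) :
  (forall a b, smooth (fun p => X p a b)) ->
  (forall a b, smooth (fun p => Y p a b)) ->
  smooth (fun p => inner (X p) (Y p)).
Proof.
by move=> sX sY; apply: smooth_sum => a; apply: smooth_sum => b; exact: smoothM.
Qed.

Lemma smooth_lin (L : {linear C4 R -> C4 R}) (X : S7 -> C4 R) a b :
  (forall a b, smooth (fun p => X p a b)) -> smooth (fun p => L (X p) a b).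
Proof.
move=> sX.
have -> : (fun p => L (X p) a b) =
    (fun p => \sum_c \sum_d X p c d * L (delta_mx c d) a b).
  apply/funext => p; rewrite {1}(matrix_sum_delta (X p)) linear_sum summxE.
  apply: eq_bigr => c _; rewrite linear_sum summxE; apply: eq_bigr => d _.
  by rewrite linearZ mxE.
apply: smooth_sum => c; apply: smooth_sum => d; apply: smoothM => //.
exact: smooth_cst.
Qed.

Lemma smooth_comp (L : {linear C4 R -> C4 R}) (h : S7 -> S7) (f : S7 -> R) :
  (forall p, pt (h p) = L (pt p)) -> smooth f -> smooth (f \o h).
Proof.
move=> hL sf p; have [U [F [oU Up CF fF]]] := sf (h p).
exists (L @^-1` U), (F \o L); split.
- by apply: open_comp => // x _; exact: mx_linear_continuous.
- by rewrite /= -hL.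
- by move=> n; exact: Ck_lin.
- by move=> q Uq; rewrite /= fF hL.
Qed.

Lemma smoothDmx (X Y : S7 -> C4 R) :
  (forall a b, smooth (fun p => X p a b)) ->
  (forall a b, smooth (fun p => Y p a b)) ->
  forall a b, smooth (fun p => (X p + Y p) a b).
Proof.
move=> sX sY a b.
by under eq_fun do rewrite mxE; exact: smoothD.
Qed.

Lemma smoothZmx (f : S7 -> R) (X : S7 -> C4 R) :
  smooth f -> (forall a b, smooth (fun p => X p a b)) ->
  forall a b, smooth (fun p => (f p *: X p) a b).
Proof.
move=> sf sX a b.
by under eq_fun do rewrite mxE; exact: smoothM.
Qed.

Lemma vadd_tangent (X Y : vfield) p : inner (X p + Y p) (pt p) = 0.
Proof. by rewrite innerDl !vf_tangent addr0. Qed.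
Definition vadd (X Y : vfield) : vfield :=
  MkVfield (vadd_tangent X Y) (smoothDmx (vf_smooth X) (vf_smooth Y)).

Lemma vscale_tangent (f : sfun) (X : vfield) p :
  inner (f p *: X p) (pt p) = 0.
Proof. by rewrite innerZl vf_tangent mulr0. Qed.
Definition vscale (f : sfun) (X : vfield) : vfield :=
  MkVfield (vscale_tangent f X) (smoothZmx (sf_smooth f) (vf_smooth X)).

Record SU4 := MkSU4 {
  su_mx : 'M[R[i]]_4 ;
  su_unitary : su_mx \is unitarymx ;
  su_det : \det su_mx = 1 }.

Lemma su_inv_unitary (s : SU4) : (su_mx s)^t* \is unitarymx.
Proof. by rewrite trmxC_unitary su_unitary. Qed.
Lemma su_inv_det (s : SU4) : \det ((su_mx s)^t* ) = 1.
Proof. by rewrite det_map_mx det_tr su_det rmorph1. Qed.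
Definition su_inv (s : SU4) : SU4 := MkSU4 (su_inv_unitary s) (su_inv_det s).

Definition su_act (s : SU4) (x : C4 R) : C4 R := ofC (su_mx s *m toC x).

Lemma su_act_linear s : linear (su_act s).
Proof.
by move=> c x y; rewrite /su_act toC_lin mulmxDr -scalemxAr ofC_lin.
Qed.
HB.instance Definition _ s :=
  GRing.isLinear.Build R (C4 R) (C4 R) _ (su_act s) (su_act_linear s).

Lemma su_act_inner s x y : inner (su_act s x) (su_act s y) = inner x y.
Proof.
rewrite !innerE !ofCK trmx_mul map_mxM mulmxA -(mulmxA _ _ (su_mx s)).
by have /unitarymxP := su_inv_unitary s; rewrite trmxCK => ->; rewrite mulmx1.
Qed.

Lemma su_act_inv s x : su_act s (su_act (su_inv s) x) = x.
Proof.
by rewrite /su_act ofCK mulmxA (unitarymxP (su_unitary s)) mul1mx toCK.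
Qed.

Lemma tau_unit s (p : S7) : inner (su_act s (pt p)) (su_act s (pt p)) == 1.
Proof. by rewrite su_act_inner pt_unit. Qed.
Definition tau (s : SU4) (p : S7) : S7 := MkS7 (tau_unit s p).

Lemma vtau_tangent s (X : vfield) p :
  inner (su_act s (X (tau (su_inv s) p))) (pt p) = 0.
Proof. by rewrite -[X in inner _ X](su_act_inv s (pt p)) su_act_inner (vf_tangent X). Qed.
Lemma vtau_smooth s (X : vfield) a b :
  smooth (fun p => su_act s (X (tau (su_inv s) p)) a b).
Proof.
apply: smooth_lin => c d.
exact: (@smooth_comp (su_act (su_inv s)) (tau (su_inv s)) (fun p => X p c d)
  (fun=> erefl) (vf_smooth X c d)).
Qed.
(* su_act s is real linear, hence equal to its own differential *)
Definition vtau (s : SU4) (X : vfield) : vfield :=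
  MkVfield (vtau_tangent s X) (vtau_smooth s X).

(* tangent and normal parts of q x, with outward normal N_p = p:
   q x = psi q p x + eta q p x N_p *)
Definition eta (q : quat R) (p : S7) (x : C4 R) : R := inner (lmulq q x) (pt p).
Definition psi (q : quat R) (p : S7) (x : C4 R) : C4 R :=
  lmulq q x - eta q p x *: pt p.
Definition xi (q : quat R) (p : S7) : C4 R := - lmulq q (pt p).
Definition Phi (q : quat R) (p : S7) (x y : C4 R) : R := inner x (psi q p y).

Lemma vpsi_tangent q (X : vfield) p : inner (psi q p (X p)) (pt p) = 0.
Proof.
by rewrite /psi -scaleNr innerDl innerZl S7_norm mulr1 subrr.
Qed.
Lemma vpsi_smooth q (X : vfield) a b : smooth (fun p => psi q p (X p) a b).
Proof.
rewrite /psi; under eq_fun do rewrite -scaleNr -mulN1r.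
apply: smoothDmx => [c d|]; first exact: smooth_lin (vf_smooth X).
apply: smoothZmx smooth_pt; apply: smoothM; first exact: smooth_cst.
by apply: smooth_inner smooth_pt => c d; exact: smooth_lin (vf_smooth X).
Qed.
Definition vpsi (q : quat R) (X : vfield) : vfield :=
  MkVfield (vpsi_tangent q X) (vpsi_smooth q X).

Definition wedge_eta_Phi (q : quat R) (p : S7) (x y z : C4 R) : R :=
  eta q p x * Phi q p y z + eta q p y * Phi q p z x + eta q p z * Phi q p x y.
Definition Omega (p : S7) (x y z : C4 R) : R :=
  wedge_eta_Phi qj p x y z - wedge_eta_Phi qk p x y z.

Definition tanproj (p : S7) (v : C4 R) : C4 R := v - inner v (pt p) *: pt p.
(* the tangent vector at p that represents the linear form phi on T_p S^7
   (sharpE below) *)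
Definition sharp (p : S7) (phi : C4 R -> R) : C4 R :=
  \matrix_(a, b) phi (tanproj p (delta_mx a b)).

(* characterized by ThetaE, Theta_tangent, tThetaE and tTheta_tangent *)
Definition Theta (p : S7) (x y : C4 R) : C4 R := sharp p (Omega p x y).
Definition tTheta (p : S7) (x y : C4 R) : C4 R :=
  sharp p (fun z => Omega p x y (psi qi p z)).

Lemma tanproj_linear p : linear (tanproj p).
Proof.
move=> c x y; rewrite /tanproj innerDl innerZl scalerBr scalerA scalerDl.
by rewrite opprD addrACA.
Qed.
HB.instance Definition _ p :=
  GRing.isLinear.Build R (C4 R) (C4 R) _ (tanproj p) (tanproj_linear p).

Lemma sharpE p (phi : {linear C4 R -> R^o}) z :
  inner (sharp p phi) z = phi (tanproj p z).
Proof.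
rewrite {2}(matrix_sum_delta z) !linear_sum; apply: eq_bigr => a _ /=.
rewrite !linear_sum; apply: eq_bigr => b _ /=.
by rewrite mxE !linearZ mulrC.
Qed.

Lemma eta_lin q p c x y : eta q p (c *: x + y) = c * eta q p x + eta q p y.
Proof. by rewrite /eta linearP innerDl innerZl. Qed.

Lemma psi_lin q p c x y : psi q p (c *: x + y) = c *: psi q p x + psi q p y.
Proof.
rewrite /psi linearP eta_lin scalerDl -scalerA scalerBr opprD.
by rewrite addrACA.
Qed.

Lemma Phi_linl q p c x y z : Phi q p (c *: x + y) z = c * Phi q p x z + Phi q p y z.
Proof. by rewrite /Phi innerDl innerZl. Qed.

Lemma Phi_linr q p c x y z : Phi q p z (c *: x + y) = c * Phi q p z x + Phi q p z y.
Proof. by rewrite /Phi psi_lin innerDr innerZr. Qed.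

Lemma Omega_linear p x y : linear (Omega p x y : C4 R -> R^o).
Proof.
move=> c z z'; rewrite /Omega /wedge_eta_Phi !eta_lin !Phi_linl !Phi_linr.
by rewrite /GRing.scale /=; ring.
Qed.
HB.instance Definition _ p x y :=
  GRing.isLinear.Build R (C4 R) R^o _ (Omega p x y) (Omega_linear p x y).

Lemma Omega_psi_linear p x y :
  linear ((fun z => Omega p x y (psi qi p z)) : C4 R -> R^o).
Proof. by move=> c z z'; rewrite psi_lin linearP. Qed.

Lemma tanproj_tangent p z : inner z (pt p) = 0 -> tanproj p z = z.
Proof. by move=> zp; rewrite /tanproj zp scale0r subr0. Qed.

Lemma tanproj_normal p : tanproj p (pt p) = 0.
Proof. by rewrite /tanproj S7_norm scale1r subrr. Qed.

Lemma ThetaE p x y z : inner z (pt p) = 0 ->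
  inner (Theta p x y) z = Omega p x y z.
Proof. by move=> /tanproj_tangent zp; rewrite sharpE zp. Qed.

Lemma Theta_tangent p x y : inner (Theta p x y) (pt p) = 0.
Proof. by rewrite sharpE tanproj_normal linear0. Qed.

Lemma tThetaE p x y z : inner z (pt p) = 0 ->
  inner (tTheta p x y) z = Omega p x y (psi qi p z).
Proof.
move=> /tanproj_tangent zp.
pose f := GRing.isLinear.Build R (C4 R) R^o _ _ (Omega_psi_linear p x y).
pose phi : {linear C4 R -> R^o} := HB.pack (fun z => Omega p x y (psi qi p z)) f.
by rewrite (sharpE p phi) /= zp.
Qed.

Lemma tTheta_tangent p x y : inner (tTheta p x y) (pt p) = 0.
Proof.
pose f := GRing.isLinear.Build R (C4 R) R^o _ _ (Omega_psi_linear p x y).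
pose phi : {linear C4 R -> R^o} := HB.pack (fun z => Omega p x y (psi qi p z)) f.
by rewrite (sharpE p phi) tanproj_normal linear0.
Qed.

End VectorFields.

Section Connections.
Context {R : realType}.
Local Notation S7 := (@S7 R).
Local Notation vfield := (@vfield R).
Local Notation sfun := (@sfun R).
Local Notation SU4 := (@SU4 R).

Record connection := MkConnection {
  conn :> vfield -> vfield -> vfield ;
  conn_addl : forall X X' Y p, conn (vadd X X') Y p = conn X Y p + conn X' Y p ;
  conn_scalel : forall (f : sfun) X Y p,
    conn (vscale f X) Y p = f p *: conn X Y p ;
  conn_addr : forall X Y Y' p, conn X (vadd Y Y') p = conn X Y p + conn X Y' p ;
  conn_leibniz : forall (f : sfun) X Y p,
    conn X (vscale f Y) p = f p *: conn X Y p + dirder f p (X p) *: Y p }.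

Definition SU4_invariant (nabla : connection) : Prop :=
  forall (s : SU4) (X Y : vfield) (p : S7),
    vtau s (nabla X Y) p = nabla (vtau s X) (vtau s Y) p.

Definition is_metric (nabla : connection) : Prop :=
  forall (X Y Z : vfield) (p : S7),
    dirder (fun q => inner (Y q) (Z q)) p (X p) =
    inner (nabla X Y p) (Z p) + inner (Y p) (nabla X Z p).

(* [X, Y]^i = X(Y^i) - Y(X^i): the commutator of the derivations X and Y
   evaluated on the real coordinate functions of C^4 *)
Definition lie (X Y : vfield) (p : S7) : C4 R :=
  \matrix_(a, b) (dirder (fun q => Y q a b) p (X p) -
                  dirder (fun q => X q a b) p (Y p)).

Definition torsion (nabla : connection) (X Y : vfield) (p : S7) : C4 R :=
  nabla X Y p - nabla Y X p - lie X Y p.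

Definition levi_civita (nabla : connection) : Prop :=
  is_metric nabla /\ forall X Y p, torsion nabla X Y p = 0.

(* C^oo-linearity in the last two slots follows from that in the first one and
   the alternation *)
Definition is_3form (w : vfield -> vfield -> vfield -> S7 -> R) : Prop :=
  [/\ forall X Y Z, smooth (w X Y Z),
      forall X X' Y Z p, w (vadd X X') Y Z p = w X Y Z p + w X' Y Z p,
      forall (f : sfun) X Y Z p, w (vscale f X) Y Z p = f p * w X Y Z p,
      forall X Y Z p, w Y X Z p = - w X Y Z p &
      forall X Y Z p, w X Z Y p = - w X Y Z p].

Definition totally_skew_torsion (nabla : connection) : Prop :=
  is_3form (fun X Y Z p => inner (torsion nabla X Y p) (Z p)).

(* (nabla_X psi)(Y) *)
Definition cov_psi (nabla : connection) (q : quat R) (X Y : vfield) (p : S7) :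
    C4 R :=
  nabla X (vpsi q Y) p - psi q p (nabla X Y p).

End Connections.
Arguments connection R : clear implicits.

(* Main.v *)
Require Import Defs.
From mathcomp Require Import all_boot all_order all_algebra.
From mathcomp Require Import complex spectral.
From mathcomp Require Import all_classical all_reals all_analysis.
From mathcomp Require Import fingroup perm ring.
Set Implicit Arguments.
Unset Strict Implicit.
Unset Printing Implicit Defensive.
Import Order.TTheory GRing.Theory Num.Theory.
Import numFieldNormedType.Exports.
Local Open Scope classical_set_scope.
Local Open Scope complex_scope.
Local Open Scope sesquilinear_scope.
Local Open Scope ring_scope.

(** The difference nabla - nablag is a tensor, invariant under SU(4) because
    nablag, which is determined by being metric and torsion free, is. So it is
    determined by a trilinear form f on the tangent space at the single point
    p0 = (1, 0, 0, 0), skew in its last two arguments and invariant under the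
    stabilizer SU(3). Write the tangent space as the line of i p0 plus C^3.
    Invariance under diagonal matrices forces f to vanish on coordinate axes
    (a, b, c) unless (a, b, c) is (0, k, k), (k, 0, k), (k, k, 0) or a
    permutation of (1, 2, 3), and determines its shape there; cyclic
    permutations of C^3 identify the remaining constants. Five real parameters
    are left, and they are those of the theorem because Omega_p(x, y, z) is the
    real part of the complex determinant of (p, x, y, z), which makes its SU(4)
    invariance evident. Total skewness of the torsion amounts to total skewness
    of f. *)

(** * Inner product and tangential projection *)

Section Inner.
Context {R : realType}.

Lemma innerNl (x y : C4 R) : inner (- x) y = - inner x y.
Proof. by rewrite -scaleN1r innerZl mulN1r. Qed.

Lemma innerNr (x y : C4 R) : inner x (- y) = - inner x y.
Proof. by rewrite innerC innerNl innerC. Qed.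

Lemma innerBl (x y z : C4 R) : inner (x - y) z = inner x z - inner y z.
Proof. by rewrite innerDl innerNl. Qed.

Lemma innerBr (x y z : C4 R) : inner z (x - y) = inner z x - inner z y.
Proof. by rewrite innerDr innerNr. Qed.

Lemma inner_ge0 (x : C4 R) : 0 <= inner x x.
Proof. by apply: sumr_ge0 => a _; apply: sumr_ge0 => b _; rewrite -expr2 sqr_ge0. Qed.

Lemma inner_eq0 (x : C4 R) : inner x x = 0 -> x = 0.
Proof.
move=> x0; apply/matrixP => a b; rewrite mxE.
have /eqP := x0; rewrite /inner psumr_eq0; last first.
  by move=> i _; apply: sumr_ge0 => j _; rewrite -expr2 sqr_ge0.
move=> /allP /(_ a); rewrite mem_index_enum => /(_ isT) /=.
rewrite psumr_eq0; last by move=> j _; rewrite -expr2 sqr_ge0.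
move=> /allP /(_ b); rewrite mem_index_enum => /(_ isT) /=.
by rewrite mulf_eq0 orbb => /eqP.
Qed.

Lemma inner_tanproj p (v : C4 R) : inner (tanproj p v) (pt p) = 0.
Proof. by rewrite innerBl innerZl S7_norm mulr1 subrr. Qed.

Lemma inner_inj_tangent (p : S7) (u w : C4 R) :
  inner u (pt p) = 0 -> inner w (pt p) = 0 ->
  (forall z, inner z (pt p) = 0 -> inner u z = inner w z) -> u = w.
Proof.
move=> up wp uw; apply/eqP; rewrite -subr_eq0; apply/eqP/inner_eq0.
by rewrite innerBl uw ?subrr// innerBl up wp subrr.
Qed.

End Inner.

(** * Directional derivatives on the sphere *)

Section DirectionalDerivative.
Context {R : realType}.
Local Notation S7 := (@S7 R).

(** The curve used in [dirder], kept as a curve in the ambient space so that the chain rule for maps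
    between normed spaces applies to it. *)
Definition radial_curve (p : S7) (v : C4 R) (t : R) : C4 R :=
  let x := pt p + t *: v in (Num.sqrt (inner x x))^-1 *: x.

Lemma inner_line (p : S7) (v : C4 R) (t : R) : inner v (pt p) = 0 ->
  inner (pt p + t *: v) (pt p + t *: v) = 1 + t ^+ 2 * inner v v.
Proof.
move=> vp; rewrite innerDl !innerDr !innerZl !innerZr S7_norm vp (innerC _ v) vp.
ring.
Qed.

Lemma inner_line_gt0 (p : S7) (v : C4 R) (t : R) : inner v (pt p) = 0 ->
  0 < inner (pt p + t *: v) (pt p + t *: v).
Proof. by move=> vp; rewrite inner_line// ltr_pwDl// mulr_ge0 ?sqr_ge0 ?inner_ge0. Qed.

Lemma radial_curve_unit (p : S7) (v : C4 R) (t : R) : inner v (pt p) = 0 ->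
  inner (radial_curve p v t) (radial_curve p v t) == 1.
Proof.
move=> vp; have x0 := inner_line_gt0 t vp; apply/eqP.
rewrite /radial_curve /= innerZl innerZr mulrA -invfM -expr2 sqr_sqrtr ?ltW//.
by rewrite mulVf// gt_eqF.
Qed.

Lemma radial_curve0 (p : S7) (v : C4 R) : radial_curve p v 0 = pt p.
Proof. by rewrite /radial_curve scale0r addr0 S7_norm sqrtr1 invr1 scale1r. Qed.

(** For tangent v the squared norm of p + t v is 1 + t^2 |v|^2, so the normalizing factor [g] has
    value 1 and derivative 0 at t = 0, and the velocity is v itself. *)
Lemma is_diff_radial_curve (p : S7) (v : C4 R) : inner v (pt p) = 0 ->
  is_diff 0 (radial_curve p v) ( *:%R^~ v).
Proof.
move=> vp; pose n2 (t : R) := 1 + t ^+ 2 * inner v v.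
pose g (t : R) := (Num.sqrt (n2 t))^-1.
have gE t : Num.sqrt (inner (pt p + t *: v) (pt p + t *: v)) = Num.sqrt (n2 t).
  by rewrite inner_line.
have -> : radial_curve p v = (fun t => g t *: pt p) + (fun t => (g t * t) *: v).
  by apply/funext => t; rewrite /radial_curve gE /= scalerDr scalerA.
have n20 : n2 0 = 1 by rewrite /n2 expr0n mul0r addr0.
have dn2 : is_derive (0 : R) 1 n2 0.
  have -> : n2 = cst 1 + (inner v v \*: (fun t : R => t ^+ 2)).
    by apply/funext => t; rewrite /n2 /= mulrC.
  by apply: is_derive_eq; rewrite add0r scale0r addr0 scaler0.
have dg : is_derive (0 : R) 1 g 0.
  have dsq : is_derive (0 : R) 1 (Num.sqrt \o n2) 0.
    have : is_derive (n2 0) 1 Num.sqrt (2 * Num.sqrt (n2 0))^-1.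
      by apply: is_derive1_sqrt; rewrite n20.
    by move=> dsq; have := is_derive1_comp dsq dn2; rewrite mulr0.
  have s0 : (Num.sqrt \o n2) 0 != 0 by rewrite /= n20 sqrtr1 oner_eq0.
  by have := is_deriveV s0 dsq; rewrite scaler0.
have dgt : is_derive (0 : R) 1 (fun t => g t * t) 1.
  have : is_derive (0 : R) 1 (g * id) 1.
    have := is_deriveM dg (is_derive_id (0 : R) 1).
    by rewrite /g n20 sqrtr1 invr1 scale1r scaler0 addr0.
  by [].
have Dg : differentiable g 0 by apply/derivable1_diffP.
have Dgt : differentiable (fun t => g t * t) 0 by apply/derivable1_diffP.
apply: DiffDef.
  by apply: differentiableD; apply: differentiableZl.
have dgE h : 'd g 0 h = 0.
  by rewrite (congr1 (fun f => f h) (diff1E Dg)) derive1E derive_val scaler0.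
have dgtE h : 'd (fun t => g t * t) 0 h = h.
  by rewrite (congr1 (fun f => f h) (diff1E Dgt)) derive1E derive_val [LHS]mulr1.
rewrite diffD; [|exact: differentiableZl..].
apply/funext => h.
have Eg : 'd (fun t => g t *: pt p) 0 h = 0.
  by have /(congr1 (fun f => f h)) /= := diffZl (pt p) Dg; rewrite dgE scale0r.
have Egt : 'd (fun t => (g t * t) *: v) 0 h = h *: v.
  by have /(congr1 (fun f => f h)) /= := diffZl v Dgt; rewrite dgtE.
by transitivity (0 + h *: v); [exact: congr2 Eg Egt|rewrite add0r].
Qed.

Lemma val_insubd_radial (p : S7) (v : C4 R) (t : R) : inner v (pt p) = 0 ->
  pt (insubd p (radial_curve p v t)) = radial_curve p v t.
Proof. by move=> vp; apply: insubdK; exact: radial_curve_unit. Qed.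

Lemma dirderE (f : S7 -> R) p v :
  dirder f p v = 'D_1 (fun t => f (insubd p (radial_curve p v t))) 0.
Proof. by rewrite /dirder derive1E. Qed.

Lemma insubd_radial0 (p : S7) v : insubd p (radial_curve p v 0) = p.
Proof. by rewrite radial_curve0; apply: valKd. Qed.

(** By continuity the curve stays near t = 0 in the open set where f has its smooth ambient
    extension, so the chain rule applies to the extension. *)
Lemma derivable_radial (f : S7 -> R) p v : smooth f -> inner v (pt p) = 0 ->
  derivable (fun t => f (insubd p (radial_curve p v t))) 0 1.
Proof.
move=> sf vp; have [U [F [oU Up CF fF]]] := sf p.
have dc := is_diff_radial_curve vp.
have dF : differentiable F (radial_curve p v 0).
  by rewrite radial_curve0; have [dF _] := CF 1%N; exact: dF.
have dFc : derivable (F \o radial_curve p v) 0 1.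
  by apply: diff_derivable; exact: differentiable_comp.
have cc : {for (0 : R), continuous (radial_curve p v)}.
  exact: differentiable_continuous.
apply: near_eq_derivable dFc.
have : \forall t \near (0 : R), U (radial_curve p v t).
  by apply: cc; rewrite radial_curve0; exact: open_nbhs_nbhs.
by apply: filterS => t Ut; rewrite fF val_insubd_radial.
Qed.

Lemma dirder_cst (c : R) p v : dirder (fun _ : S7 => c) p v = 0.
Proof. by rewrite dirderE; exact: derive_cst. Qed.

Lemma dirderD (f g : S7 -> R) p v : smooth f -> smooth g -> inner v (pt p) = 0 ->
  dirder (fun q => f q + g q) p v = dirder f p v + dirder g p v.
Proof.
by move=> sf sg vp; rewrite !dirderE -deriveD//; exact: derivable_radial.
Qed.

Lemma dirderM (f g : S7 -> R) p v : smooth f -> smooth g -> inner v (pt p) = 0 ->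
  dirder (fun q => f q * g q) p v = dirder f p v * g p + f p * dirder g p v.
Proof.
move=> sf sg vp; rewrite !dirderE [LHS]deriveM; [|exact: derivable_radial..].
have at0 h : h (insubd p (radial_curve p v 0)) = h p :> R by rewrite insubd_radial0.
exact: etrans (addrC _ _) (congr2 +%R
  (etrans (congr1 (fun c => c * _) (at0 g)) (mulrC _ _))
  (congr1 (fun c => c * _) (at0 f))).
Qed.

Lemma dirder_sum (I : finType) (f : I -> S7 -> R) p v :
  (forall i, smooth (f i)) -> inner v (pt p) = 0 ->
  dirder (fun q => \sum_i f i q) p v = \sum_i dirder (f i) p v.
Proof.
move=> sf vp; elim: (index_enum I) => [|i r IH].
  by under eq_fun do rewrite big_nil; rewrite big_nil dirder_cst.
under eq_fun do rewrite big_cons; rewrite big_cons -IH dirderD//.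
elim: r {IH} => [|j r IH]; first by under eq_fun do rewrite big_nil; exact: smooth_cst.
by under eq_fun do rewrite big_cons; exact: smoothD.
Qed.

Lemma dirder_pt a b p (v : C4 R) : inner v (pt p) = 0 ->
  dirder (fun q : S7 => pt q a b) p v = v a b.
Proof.
move=> vp; rewrite dirderE.
under eq_fun do rewrite val_insubd_radial//.
have dc := is_diff_radial_curve vp.
have dab x : differentiable (fun x : C4 R => x a b) x by exact: differentiable_coord.
have -> : (fun t => radial_curve p v t a b) =
  (fun x : C4 R => x a b) \o radial_curve p v by [].
rewrite deriveE; last exact: differentiable_comp.
rewrite diff_comp//= diff_val /= scale1r -deriveE//.
apply: cvg_lim => //; apply: cvg_near_cst; near=> h.
rewrite /= !mxE addrK /GRing.scale /= mulrA mulVf ?mul1r //.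
by near: h; exact: nbhs_dnbhs_neq.
Unshelve. all: by end_near. Qed.

(** A linear isometry carries the radial curve of (p, v) to that of (s p, s v). *)
Lemma dirder_tau (f : S7 -> R) s p v : inner v (pt p) = 0 ->
  dirder (fun q => f (tau s q)) p v = dirder f (tau s p) (su_act s v).
Proof.
move=> vp; rewrite !dirderE.
have vp' : inner (su_act s v) (pt (tau s p)) = 0 by rewrite su_act_inner.
congr (derive _ _ _); apply/funext => t; congr f; apply: val_inj.
rewrite /= !val_insubd_radial// /radial_curve /=.
by rewrite -!linearZ/= -linearD su_act_inner linearZ.
Qed.

(** The flat derivative of the ambient space along v; its tangential part will be the Levi-Civita
    connection. *)
Definition vdirder (X : S7 -> C4 R) (p : S7) (v : C4 R) : C4 R :=
  \matrix_(a, b) dirder (fun q => X q a b) p v.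

Lemma vdirderD (X Y : S7 -> C4 R) p v :
  (forall a b, smooth (fun p => X p a b)) ->
  (forall a b, smooth (fun p => Y p a b)) -> inner v (pt p) = 0 ->
  vdirder (fun q => X q + Y q) p v = vdirder X p v + vdirder Y p v.
Proof.
move=> sX sY vp; apply/matrixP => a b; rewrite !mxE -dirderD//.
by under eq_fun do rewrite mxE.
Qed.

Lemma vdirderZ (f : S7 -> R) (X : S7 -> C4 R) p v :
  smooth f -> (forall a b, smooth (fun p => X p a b)) -> inner v (pt p) = 0 ->
  vdirder (fun q => f q *: X q) p v = dirder f p v *: X p + f p *: vdirder X p v.
Proof.
move=> sf sX vp; apply/matrixP => a b; rewrite !mxE -dirderM//.
by under eq_fun do rewrite mxE.
Qed.

Lemma vdirder_pt p v : inner v (pt p) = 0 -> vdirder (@pt R) p v = v.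
Proof. by move=> vp; apply/matrixP => a b; rewrite mxE dirder_pt. Qed.

Lemma dirder_inner (X Y : S7 -> C4 R) p v :
  (forall a b, smooth (fun p => X p a b)) ->
  (forall a b, smooth (fun p => Y p a b)) -> inner v (pt p) = 0 ->
  dirder (fun q => inner (X q) (Y q)) p v =
    inner (vdirder X p v) (Y p) + inner (X p) (vdirder Y p v).
Proof.
move=> sX sY vp; rewrite dirder_sum//; last first.
  by move=> a; apply: smooth_sum => b; exact: smoothM.
rewrite /inner -big_split; apply: eq_bigr => a _ /=.
rewrite dirder_sum//; last by move=> b; exact: smoothM.
by rewrite -big_split; apply: eq_bigr => b _ /=; rewrite !mxE dirderM.
Qed.

Lemma vdirder_lin (L : {linear C4 R -> C4 R}) (X : S7 -> C4 R) p v :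
  (forall a b, smooth (fun p => X p a b)) -> inner v (pt p) = 0 ->
  vdirder (fun q => L (X q)) p v = L (vdirder X p v).
Proof.
move=> sX vp; have LE (y : C4 R) a b :
    L y a b = \sum_c \sum_d y c d * L (delta_mx c d) a b.
  rewrite {1}(matrix_sum_delta y) linear_sum summxE.
  apply: eq_bigr => c _; rewrite linear_sum summxE; apply: eq_bigr => d _.
  by rewrite linearZ mxE.
apply/matrixP => a b; rewrite mxE LE.
under eq_fun do rewrite LE.
have sXL c d : smooth (fun q => X q c d * L (delta_mx c d) a b).
  by apply: smoothM => //; exact: smooth_cst.
rewrite dirder_sum// => [|c]; last exact: smooth_sum.
apply: eq_bigr => c _; rewrite dirder_sum//; apply: eq_bigr => d _.
rewrite dirderM//; last exact: smooth_cst.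
by rewrite dirder_cst mulr0 addr0 mxE.
Qed.

Lemma vdirder_tau (X : S7 -> C4 R) s p v : inner v (pt p) = 0 ->
  vdirder (fun q => X (tau s q)) p v = vdirder X (tau s p) (su_act s v).
Proof.
move=> vp; apply/matrixP => a b; rewrite !mxE.
exact: (dirder_tau (fun q => X q a b)).
Qed.

End DirectionalDerivative.

(** * The difference tensor of two connections *)

Section ProjectedFields.
Context {R : realType}.
Local Notation S7 := (@S7 R).
Local Notation vfield := (@vfield R).
Local Notation sfun := (@Defs.sfun R).

Lemma vfield_ext (X Y : vfield) : (forall p, X p = Y p) -> X = Y.
Proof.
case: X Y => [X Xt Xs] [Y Yt Ys] /= /funext XY; case: _ / XY in Yt Ys *.
by congr MkVfield; exact: Prop_irrelevance.
Qed.

Definition cst_sfun (c : R) : sfun := MkSfun (smooth_cst c).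

Definition coord_sfun (X : vfield) a b : sfun := MkSfun (vf_smooth X a b).

Lemma tanproj_smooth (v : C4 R) a b : smooth (fun p => tanproj p v a b).
Proof.
rewrite /tanproj; under eq_fun do rewrite -scaleNr -mulN1r.
apply: smoothDmx => [c d|]; first exact: smooth_cst.
apply: smoothZmx smooth_pt; apply: smoothM; first exact: smooth_cst.
by apply: smooth_inner smooth_pt => c d; exact: smooth_cst.
Qed.

Definition proj_field (v : C4 R) : vfield :=
  MkVfield (fun p => inner_tanproj p v) (tanproj_smooth v).

Lemma proj_fieldP c x y :
  proj_field (c *: x + y) = vadd (vscale (cst_sfun c) (proj_field x)) (proj_field y).
Proof. by apply: vfield_ext => p; rewrite /= linearP. Qed.

Lemma vtau_proj_field s x : vtau s (proj_field x) = proj_field (su_act s x).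
Proof.
apply: vfield_ext => p; rewrite /= /tanproj linearB linearZ /= su_act_inv.
by rewrite -(su_act_inner s x) su_act_inv.
Qed.

(* The projections of the constant fields span every tangent space, so that
   X = \sum_ab X_ab E_ab for the global frame-like family
   E_ab = proj_field (delta_mx a b). *)
Lemma tensorial_proj (T : vfield -> C4 R) (p : S7) (X : vfield) :
  (forall X Y, T (vadd X Y) = T X + T Y) ->
  (forall (f : sfun) X, T (vscale f X) = f p *: T X) ->
  T X = T (proj_field (X p)).
Proof.
move=> TD TZ.
pose vsum (f : 'I_4 * 'I_2 -> sfun) :=
  foldr (fun ab Y => vadd (vscale (f ab) (proj_field (delta_mx ab.1 ab.2))) Y)
    (proj_field 0).
have T0 : T (proj_field 0) = 0.
  have -> : proj_field 0 = vscale (cst_sfun 0) (proj_field 0).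
    by apply: vfield_ext => q; rewrite /= linear0 scaler0.
  by rewrite TZ scale0r.
have vsumE f s q :
    vsum f s q = \sum_(ab <- s) f ab q *: tanproj q (delta_mx ab.1 ab.2).
  by elim: s => [|ab s IH]; rewrite ?big_nil ?big_cons /= ?linear0 ?IH.
have TvsumE f s : T (vsum f s) =
    \sum_(ab <- s) f ab p *: T (proj_field (delta_mx ab.1 ab.2)).
  by elim: s => [|ab s IH]; rewrite ?big_nil ?big_cons /= ?T0// TD TZ IH.
have vsum_index f q : vsum f (index_enum _) q =
    tanproj q (\sum_a \sum_b f (a, b) q *: delta_mx a b).
  rewrite vsumE pair_bigA linear_sum; apply: eq_bigr => -[a b] _ /=.
  by rewrite linearZ.
have -> : X = vsum (fun ab => coord_sfun X ab.1 ab.2) (index_enum _).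
  apply: vfield_ext => q; rewrite vsum_index -matrix_sum_delta.
  by rewrite tanproj_tangent// vf_tangent.
rewrite TvsumE.
set v := (vsum _ _ p).
(* The same family with the coefficients of X frozen at p: T sees only the values of the
   coefficients at p, so both sums have the same image. *)
have -> : proj_field v = vsum (fun ab => cst_sfun (X p ab.1 ab.2)) (index_enum _).
  apply: vfield_ext => q; rewrite vsum_index /v vsum_index -!matrix_sum_delta.
  by rewrite tanproj_tangent// vf_tangent.
by rewrite TvsumE.
Qed.

Lemma su_actK s (x : C4 R) : su_act (su_inv s) (su_act s x) = x.
Proof.
have <- : su_act (su_inv (su_inv s)) x = su_act s x by rewrite /su_act /= trmxCK.
exact: su_act_inv.
Qed.

Lemma tauK s (p : S7) : tau (su_inv s) (tau s p) = p.
Proof. by apply: val_inj; exact: su_actK. Qed.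

End ProjectedFields.

(** * Levi-Civita connection as tangential part of the flat derivative *)

Section LeviCivita.
Context {R : realType}.
Local Notation S7 := (@S7 R).
Local Notation vfield := (@vfield R).
Variables (nablag : connection R) (nablag_LC : levi_civita nablag).

Lemma lieE (X Y : vfield) p :
  lie X Y p = vdirder Y p (X p) - vdirder X p (Y p).
Proof. by apply/matrixP => a b; rewrite !mxE. Qed.

(* The difference of both sides is skew in (Y, Z) because nablag is metric and
   symmetric in (X, Y) because it is torsion free. *)
Lemma levi_civitaE (X Y Z : vfield) p :
  inner (nablag X Y p) (Z p) = inner (vdirder Y p (X p)) (Z p).
Proof.
have [nmet ntor] := nablag_LC.
pose S (X Y Z : vfield) := inner (nablag X Y p - vdirder Y p (X p)) (Z p).
have Sskew X' Y' Z' : S X' Y' Z' = - S X' Z' Y'.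
  have := nmet X' Y' Z' p; rewrite dirder_inner ?vf_tangent//; last first.
  - exact: vf_smooth.
  - exact: vf_smooth.
  move=> /eqP; rewrite addrC -subr_eq => /eqP E.
  rewrite /S !innerBl (innerC (nablag X' Z' p)) (innerC (vdirder Z' p _)) opprB.
  by rewrite -[inner (vdirder Y' _ _) _]opprK; rewrite -E; ring.
have swap (V : zmodType) (a b c d : V) : a - b - (c - d) = 0 -> a - c = b - d.
  move=> E; apply/eqP; rewrite -subr_eq0 -E; apply/eqP.
  by rewrite !opprB addrACA [RHS]addrACA (addrC (- c)).
have Ssym X' Y' Z' : S X' Y' Z' = S Y' X' Z'.
  have := ntor X' Y' p; rewrite /torsion lieE => /swap E.
  by rewrite /S E.
(* Six alternating transpositions bring (X, Y, Z) back to itself; three of them change the sign. *)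
have S0 : S X Y Z = - S X Y Z.
  by rewrite {1}Sskew Ssym Sskew Ssym Sskew Ssym opprK.
apply/eqP; rewrite -subr_eq0 -innerBl -/(S X Y Z).
by move/eqP: S0; rewrite -subr_eq0 opprK -mulr2n mulrn_eq0.
Qed.

(** By [levi_civitaE] tangential pairings with [nablag] are pairings with the flat derivative, which
    commutes with linear isometries. *)
Lemma levi_civita_invariant : SU4_invariant nablag.
Proof.
move=> s X Y p; apply: (@inner_inj_tangent _ p); try exact: vf_tangent.
move=> z zp.
have zE : z = proj_field z p by rewrite /= tanproj_tangent.
rewrite [in RHS]zE levi_civitaE -zE.
have -> : vdirder (vtau s Y) p (vtau s X p) =
    su_act s (vdirder Y (tau (su_inv s) p) (X (tau (su_inv s) p))).
  have XT : inner (vtau s X p) (pt p) = 0 by exact: vf_tangent.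
  rewrite (vdirder_lin (su_act s) _ XT); last first.
    move=> a b; exact: (@smooth_comp _ (su_act (su_inv s)) (tau (su_inv s))
      (fun p => Y p a b) (fun=> erefl) (vf_smooth Y a b)).
  by rewrite (vdirder_tau Y (su_inv s) XT) /= su_actK.
rewrite -[z](su_act_inv s) !su_act_inner.
have w0 : inner (su_act (su_inv s) z) (pt (tau (su_inv s) p)) = 0.
  by rewrite su_act_inner.
have wE : su_act (su_inv s) z = proj_field (su_act (su_inv s) z) (tau (su_inv s) p).
  by rewrite /= tanproj_tangent.
by rewrite wE levi_civitaE.
Qed.

End LeviCivita.

(** * Tensoriality, skewness and invariance of the difference *)

Section DifferenceTensor.
Context {R : realType}.
Local Notation S7 := (@S7 R).
Local Notation vfield := (@vfield R).
Variables (nablag nabla : connection R).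

Definition conn_diff (X Y : vfield) (p : S7) : C4 R := nabla X Y p - nablag X Y p.

(** The arguments range over all of C^4, which avoids a type of tangent vectors; only their
    tangential projections at p matter. *)
Definition difftensor (p : S7) (x y z : C4 R) : R :=
  inner (conn_diff (proj_field x) (proj_field y) p) z.

(** The derivative terms of the two Leibniz rules cancel, so the difference is tensorial in both
    slots and [tensorial_proj] applies to each. *)
Lemma conn_diff_proj X Y p :
  conn_diff X Y p = conn_diff (proj_field (X p)) (proj_field (Y p)) p.
Proof.
transitivity (conn_diff (proj_field (X p)) Y p).
  apply: (@tensorial_proj _ (fun X => conn_diff X Y p) p X) => [X1 X2|f X1].
    by rewrite /conn_diff !conn_addl opprD addrACA.
  by rewrite /conn_diff !conn_scalel scalerBr.
apply: (@tensorial_proj _ (conn_diff (proj_field (X p)) ^~ p) p Y) => [X1 X2|f X1].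
  by rewrite /conn_diff !conn_addr opprD addrACA.
by rewrite /conn_diff !conn_leibniz scalerBr opprD addrACA subrr addr0.
Qed.

Lemma difftensorE X Y p z : inner (conn_diff X Y p) z = difftensor p (X p) (Y p) z.
Proof. by rewrite conn_diff_proj. Qed.

Lemma conn_diff_tangent X Y p : inner (conn_diff X Y p) (pt p) = 0.
Proof. by rewrite innerBl !vf_tangent subrr. Qed.

Lemma difftensorPl p c (x x' : C4 R) y z :
  difftensor p (c *: x + x') y z = c * difftensor p x y z + difftensor p x' y z.
Proof.
rewrite /difftensor /conn_diff !proj_fieldP !conn_addl !conn_scalel /=.
by rewrite !innerBl !innerDl !innerZl; ring.
Qed.

Lemma difftensorPm p c x (y y' : C4 R) z :
  difftensor p x (c *: y + y') z = c * difftensor p x y z + difftensor p x y' z.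
Proof.
rewrite /difftensor /conn_diff !proj_fieldP !conn_addr !conn_leibniz /=.
by rewrite !dirder_cst !scale0r !addr0 !innerBl !innerDl !innerZl; ring.
Qed.

Lemma difftensorPr p c x y (z z' : C4 R) :
  difftensor p x y (c *: z + z') = c * difftensor p x y z + difftensor p x y z'.
Proof. by rewrite /difftensor innerDr innerZr. Qed.

Hypothesis nablag_LC : levi_civita nablag.

(** Both connections are metric, and subtracting the two identities removes the derivative of the
    inner product. *)
Lemma difftensor_skew p x y z : is_metric nabla ->
  inner y (pt p) = 0 -> inner z (pt p) = 0 ->
  difftensor p x y z = - difftensor p x z y.
Proof.
move=> nmet yp zp; have [gmet _] := nablag_LC.
have yE : y = proj_field y p by rewrite /= tanproj_tangent.
have zE : z = proj_field z p by rewrite /= tanproj_tangent.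
have := nmet (proj_field x) (proj_field y) (proj_field z) p.
rewrite gmet -!yE -!zE => E.
rewrite /difftensor /conn_diff !innerBl (innerC (nabla _ (proj_field z) p)).
rewrite (innerC (nablag _ (proj_field z) p)) opprB.
by apply/eqP; rewrite subr_eq addrAC eq_sym subr_eq -E addrC.
Qed.

(** Both connections are invariant, and [vtau] permutes the projected constant fields. *)
Lemma difftensor_inv p s x y z : SU4_invariant nabla ->
  difftensor (tau s p) (su_act s x) (su_act s y) (su_act s z) = difftensor p x y z.
Proof.
move=> ninv; have ginv := levi_civita_invariant nablag_LC.
rewrite /difftensor /conn_diff -!vtau_proj_field -ninv -ginv /= tauK.
by rewrite -linearB su_act_inner.
Qed.

End DifferenceTensor.

(** * Complex volume form *)

Section Coordinates.
Context {R : realType}.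

Lemma sum4E (V : nmodType) (F : 'I_4 -> V) : \sum_a F a = F 0 + F 1 + F 2 + F 3.
Proof.
rewrite !big_ord_recl big_ord0 addr0 !addrA.
by congr (F _ + F _ + F _ + F _); apply: val_inj.
Qed.

Lemma I4P (a : 'I_4) : [\/ a = 0, a = 1, a = 2 | a = 3].
Proof.
case: a => [[|[|[|[|//]]]] Ha].
- by apply: Or41; apply: val_inj.
- by apply: Or42; apply: val_inj.
- by apply: Or43; apply: val_inj.
- by apply: Or44; apply: val_inj.
Qed.

Lemma inner_coord (x y : C4 R) : inner x y =
  x 0 0 * y 0 0 + x 0 1 * y 0 1 + (x 1 0 * y 1 0 + x 1 1 * y 1 1)
  + (x 2 0 * y 2 0 + x 2 1 * y 2 1) + (x 3 0 * y 3 0 + x 3 1 * y 3 1).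
Proof. by rewrite /inner sum4E !sum2E. Qed.

Lemma lmulqi_coord (x : C4 R) a :
  (lmulq qi x a 0 = - x a 1) * (lmulq qi x a 1 = x a 0).
Proof.
by have [->|->|->|->] := I4P a; rewrite !mxE /=; split; rewrite ?mxE /=; ring.
Qed.

Lemma lmulqj_coord (x : C4 R) :
  ((lmulq qj x 0 0 = - x 1 0) * (lmulq qj x 0 1 = x 1 1) *
  (lmulq qj x 1 0 = x 0 0) * (lmulq qj x 1 1 = - x 0 1)) *
  ((lmulq qj x 2 0 = - x 3 0) * (lmulq qj x 2 1 = x 3 1) *
  (lmulq qj x 3 0 = x 2 0) * (lmulq qj x 3 1 = - x 2 1)).
Proof. by do !split; rewrite ?mxE /=; ring. Qed.

Lemma lmulqk_coord (x : C4 R) :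
  ((lmulq qk x 0 0 = - x 1 1) * (lmulq qk x 0 1 = - x 1 0) *
  (lmulq qk x 1 0 = x 0 1) * (lmulq qk x 1 1 = x 0 0)) *
  ((lmulq qk x 2 0 = - x 3 1) * (lmulq qk x 2 1 = - x 3 0) *
  (lmulq qk x 3 0 = x 2 1) * (lmulq qk x 3 1 = x 2 0)).
Proof. by do !split; rewrite ?mxE /=; ring. Qed.

End Coordinates.

Section Determinant.
Context {R : realType}.

(** The Laplace expansion along the top rows, written out as a polynomial so that determinant
    identities become ring identities; [m] and [M] are the minors of the lower two and three
    rows. *)
Definition det4 (S : comNzRingType) (B : nat -> nat -> S) : S :=
  let m i j := B 2%N i * B 3%N j - B 2%N j * B 3%N i in
  let M i j k := B 1%N i * m j k - B 1%N j * m i k + B 1%N k * m i j in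
  B 0%N 0%N * M 1%N 2%N 3%N - B 0%N 1%N * M 0%N 2%N 3%N
  + B 0%N 2%N * M 0%N 1%N 3%N - B 0%N 3%N * M 0%N 1%N 2%N.

Lemma det_mx44 (S : comNzRingType) (B : nat -> nat -> S) :
  \det (\matrix_(i < 4, j < 4) B i j) = det4 B.
Proof.
do 3 rewrite ?(expand_det_row _ ord0) !big_ord_recl ?big_ord0 /cofactor.
rewrite /det4 !det_mx11 !mxE /= /bump /= !expr0 !addn0 !add0n !add1n; ring.
Qed.

End Determinant.

Section ComplexVolume.
Context {R : realType}.

Definition cdet (p x y z : C4 R) : R[i] :=
  \det (\matrix_(a < 4, b < 4) toC [:: p; x; y; z]`_b a 0).

(** The matrix with columns s p, s x, s y, s z is the product of s with the one for p, x, y, z, and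
    s has determinant 1. *)
Lemma cdet_act s (p x y z : C4 R) :
  cdet (su_act s p) (su_act s x) (su_act s y) (su_act s z) = cdet p x y z.
Proof.
rewrite /cdet -[RHS]mul1r -(su_det s) -det_mulmx; congr (\det _).
apply/matrixP => a b; rewrite [LHS]mxE [RHS]mxE.
transitivity ((su_mx s *m toC [:: p; x; y; z]`_b) a 0).
  by case: b => [[|[|[|[|//]]]] b4] /=; rewrite /su_act ofCK.
by rewrite mxE; apply: eq_bigr => k _; rewrite [in RHS]mxE.
Qed.

Lemma cdetE (p x y z : C4 R) : cdet p x y z =
  det4 (fun a b => toC [:: p; x; y; z]`_b (inord a) 0).
Proof.
rewrite -det_mx44; congr (\det _); apply/matrixP => a b.
by rewrite mxE [in RHS]mxE inord_val.
Qed.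

Lemma cdet_coord (p x y z : C4 R) : cdet p x y z =
  det4 (fun a b => let v := [:: p; x; y; z]`_b in v (inord a) 0 +i* v (inord a) 1).
Proof. by rewrite cdetE /det4 /= !mxE. Qed.

Lemma inord4 : (inord 0 = 0 :> 'I_4) * (inord 1 = 1 :> 'I_4) *
  (inord 2 = 2 :> 'I_4) * (inord 3 = 3 :> 'I_4).
Proof. by do !split; apply: val_inj; rewrite /= inordK. Qed.

Lemma Phi_tangent q (p : @S7 R) (x y : C4 R) : inner x (pt p) = 0 ->
  Phi q p x y = inner (lmulq q y) x.
Proof. by move=> xp; rewrite /Phi /psi innerBr innerZr xp mulr0 subr0 innerC. Qed.

Lemma wedge_eta_PhiE q (p : @S7 R) (x y z : C4 R) :
  inner x (pt p) = 0 -> inner y (pt p) = 0 -> inner z (pt p) = 0 ->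
  wedge_eta_Phi q p x y z =
    inner (lmulq q x) (pt p) * inner (lmulq q z) y
    + inner (lmulq q y) (pt p) * inner (lmulq q x) z
    + inner (lmulq q z) (pt p) * inner (lmulq q y) x.
Proof. by move=> xp yp zp; rewrite /wedge_eta_Phi !Phi_tangent. Qed.

Lemma inner_lmulqi (x y : C4 R) : inner (lmulq qi x) y =
  - x 0 1 * y 0 0 + x 0 0 * y 0 1 + (- x 1 1 * y 1 0 + x 1 0 * y 1 1)
  + (- x 2 1 * y 2 0 + x 2 0 * y 2 1) + (- x 3 1 * y 3 0 + x 3 0 * y 3 1).
Proof. by rewrite inner_coord !lmulqi_coord. Qed.

Lemma inner_lmulqj (x y : C4 R) : inner (lmulq qj x) y =
  - x 1 0 * y 0 0 + x 1 1 * y 0 1 + (x 0 0 * y 1 0 - x 0 1 * y 1 1)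
  + (- x 3 0 * y 2 0 + x 3 1 * y 2 1) + (x 2 0 * y 3 0 - x 2 1 * y 3 1).
Proof. by rewrite inner_coord !lmulqj_coord !mulNr. Qed.

Lemma inner_lmulqk (x y : C4 R) : inner (lmulq qk x) y =
  - x 1 1 * y 0 0 - x 1 0 * y 0 1 + (x 0 1 * y 1 0 + x 0 0 * y 1 1)
  + (- x 3 1 * y 2 0 - x 3 0 * y 2 1) + (x 2 1 * y 3 0 + x 2 0 * y 3 1).
Proof. by rewrite inner_coord !lmulqk_coord !mulNr. Qed.

(** Tangency replaces each [psi] in [Phi] by left multiplication; what remains is a polynomial
    identity in the real coordinates of the four vectors. *)
Lemma Omega_cdet (p : @S7 R) (x y z : C4 R) :
  inner x (pt p) = 0 -> inner y (pt p) = 0 -> inner z (pt p) = 0 ->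
  Omega p x y z = complex.Re (cdet (pt p) x y z).
Proof.
move=> xp yp zp; rewrite /Omega (wedge_eta_PhiE qj)// (wedge_eta_PhiE qk)//.
rewrite !inner_lmulqj.
rewrite !inner_lmulqk.
rewrite cdet_coord.
rewrite /det4.
rewrite /=.
rewrite !inord4.
ring.
Qed.

Lemma toC_lmulqi (x : C4 R) : toC (lmulq qi x) = 'i%C *: toC x.
Proof.
apply/matrixP => a b; rewrite !(ord1 b) mxE [RHS]mxE [toC x a 0]mxE !lmulqi_coord.
by apply/eqP; rewrite eq_complex /= !mul0r !mul1r sub0r add0r !eqxx.
Qed.

(** [psi qi p z] differs from i z by a multiple of p, which is already a column of the
    determinant. *)
Lemma cdet_psi (p : @S7 R) (x y z : C4 R) :
  cdet (pt p) x y (psi qi p z) = 'i%C * cdet (pt p) x y z.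
Proof.
have psiE a : toC (psi qi p z) a 0 =
    'i%C * toC z a 0 - (eta qi p z)%:C * toC (pt p) a 0.
  have -> : psi qi p z = - eta qi p z *: pt p + lmulq qi z by rewrite scaleNr addrC.
  by rewrite toC_lin toC_lmulqi mxE [X in X + _]mxE [X in _ + X]mxE rmorphN mulNr addrC.
rewrite !cdetE /det4 [nth _ _ _]/=.
rewrite /= !psiE.
ring.
Qed.

Lemma Omega_psi_cdet (p : @S7 R) (x y z : C4 R) :
  inner x (pt p) = 0 -> inner y (pt p) = 0 -> inner z (pt p) = 0 ->
  Omega p x y (psi qi p z) = - complex.Im (cdet (pt p) x y z).
Proof.
move=> xp yp zp; rewrite Omega_cdet//; last first.
  by rewrite /psi innerBl innerZl S7_norm mulr1 subrr.
by rewrite cdet_psi; case: (cdet _ _ _ _) => a b /=; rewrite mul0r mul1r sub0r.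
Qed.

Lemma su_act_lmulqi s (x : C4 R) : su_act s (lmulq qi x) = lmulq qi (su_act s x).
Proof.
by rewrite -[RHS]toCK toC_lmulqi /su_act ofCK toC_lmulqi -scalemxAr.
Qed.

Lemma inner_lmulqi_skew (x y : C4 R) : inner (lmulq qi x) y = - inner (lmulq qi y) x.
Proof. by rewrite !inner_lmulqi; ring. Qed.

(* The five terms pair z with the five tensors of the theorem applied to (x, y);
   the last one corresponds to - tTheta. *)
Definition invform (k1 k2 k3 k4 k5 : R) (p x y z : C4 R) : R :=
  let et x := inner (lmulq qi x) p in
  k1 * (inner (lmulq qi y) x * et z - inner (lmulq qi z) x * et y)
  + k2 * (inner x y * et z - inner x z * et y)
  + k3 * (et x * inner (lmulq qi y) z)
  + k4 * complex.Re (cdet p x y z) + k5 * complex.Im (cdet p x y z).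

Lemma invform_act k1 k2 k3 k4 k5 s (p x y z : C4 R) :
  invform k1 k2 k3 k4 k5 (su_act s p) (su_act s x) (su_act s y) (su_act s z) =
  invform k1 k2 k3 k4 k5 p x y z.
Proof.
have il a b : inner (lmulq qi (su_act s a)) (su_act s b) = inner (lmulq qi a) b.
  by rewrite -su_act_lmulqi su_act_inner.
rewrite /invform cdet_act; move: (su_act_inner s) il.
move: (su_act s) (lmulq qi) => L J Linner LJ.
by rewrite !LJ !Linner.
Qed.

End ComplexVolume.

(** * Invariant forms at the base point *)

Section SpecialUnitary.
Context {R : realType}.

Definition cvec (a : 'I_4) (u : R[i]) : C4 R := ofC (u *: delta_mx a 0).

Lemma cvec_coord a u i b :
  cvec a u i b = if i == a then if b == 0 then complex.Re u else complex.Im u else 0.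
Proof.
by rewrite !mxE andbT; case: (i == a); rewrite ?mulr1 ?mulr0; case: (b == 0).
Qed.

Lemma cvecE a u : cvec a u = complex.Re u *: cvec a 1 + complex.Im u *: cvec a 'i%C.
Proof.
apply/matrixP => i b; rewrite [RHS]mxE [X in X + _]mxE [X in _ + X]mxE !cvec_coord.
by case: (i == a); case: (b == 0); rewrite /=; ring.
Qed.

Lemma C4_sum_cvec (x : C4 R) : x = \sum_a cvec a (toC x a 0).
Proof.
apply/matrixP => a b; rewrite summxE (bigD1 a)//= big1 => [|k ka].
  by rewrite addr0 cvec_coord eqxx mxE; have [->|->] := I2P b.
by rewrite cvec_coord eq_sym (negbTE ka).
Qed.

Lemma su_act_cvec s a u : su_act s (cvec a u) = ofC (u *: col a (su_mx s)).
Proof.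
by rewrite /su_act ofCK -scalemxAr colE.
Qed.

Lemma diag_mx_unitary (d : 'rV[R[i]]_4) :
  (forall k, d 0 k * Num.conj (d 0 k) = 1) -> diag_mx d \is unitarymx.
Proof.
move=> d1; apply/unitarymxP; rewrite tr_diag_mx map_diag_mx mulmx_diag.
rewrite -diag_const_mx; congr diag_mx; apply/rowP => k; rewrite !mxE.
exact: d1.
Qed.

(** The diagonal matrix with c at a, its conjugate at b and 1 elsewhere has determinant |c|^2 = 1.
    For a and b nonzero it fixes the base point. *)
Lemma torus_exists (a b : 'I_4) (c : R[i]) : a != b -> c * Num.conj c = 1 ->
  exists s : SU4, forall k u, su_act s (cvec k u) =
    cvec k ((if k == a then c else if k == b then Num.conj c else 1) * u).
Proof.
move=> ab c1; pose d : 'rV[R[i]]_4 :=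
  \row_k (if k == a then c else if k == b then Num.conj c else 1).
have du : diag_mx d \is unitarymx.
  apply: diag_mx_unitary => k; rewrite !mxE.
  case: (k == a); first by [].
  case: (k == b); first by rewrite -[RHS]c1 mulrC; congr (_ * _); exact: conjCK.
  by rewrite rmorph1 mulr1.
have dd : \det (diag_mx d) = 1.
  rewrite det_diag (bigD1 a)//= (bigD1 b)//= ?(eq_sym b)// big1 => [|k /andP[ka kb]].
    by rewrite !mxE eqxx eq_sym (negbTE ab) eqxx mulr1.
  by rewrite mxE (negbTE ka) (negbTE kb).
exists (MkSU4 du dd) => k u; rewrite su_act_cvec /cvec; congr ofC.
apply/matrixP => i j; rewrite (ord1 j) !mxE mulrC.
have [->|ik] := eqVneq i k; first by rewrite mulr1n mulr1 mulrC.
by rewrite mulr0n mulr0 mul0r.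
Qed.

Lemma perm_exists (g : {perm 'I_4}) : ~~ odd_perm g ->
  exists s : @SU4 R, forall k u, su_act s (cvec k u) = cvec (g k) u.
Proof.
move=> ge.
(* The inverse appears because column k of [perm_mx h] has its 1 in the row i with h i = k. *)
have gu : perm_mx g^-1%g \is @unitarymx R[i] 4 4.
  apply/unitarymxP; rewrite tr_perm_mx map_perm_mx -perm_mxM invgK mulVg.
  exact: perm_mx1.
have gd : \det (perm_mx g^-1%g : 'M[R[i]]_4) = 1.
  by rewrite det_perm odd_permV (negbTE ge) expr0.
exists (MkSU4 gu gd) => k u; rewrite su_act_cvec /cvec; congr ofC.
apply/matrixP => i j; rewrite (ord1 j) !mxE; congr (_ * _%:R).
by rewrite andbT -(inj_eq (@perm_inj _ g)) permKV.
Qed.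

Lemma inner_cvec a b (u v : R[i]) : inner (cvec a u) (cvec b v) =
  if a == b then complex.Re u * complex.Re v + complex.Im u * complex.Im v else 0.
Proof.
move: (cvec_coord a u) (cvec_coord b v).
move: (cvec a u) (cvec b v) => x y xE yE; rewrite inner_coord !xE !yE /=.
by have [->|->|->|->] := I4P a; have [->|->|->|->] := I4P b; rewrite /=; ring.
Qed.

Definition base_point : @S7 R.
Proof.
by apply: (@MkS7 _ (cvec 0 1)); rewrite inner_cvec /= mulr0 addr0 mulr1.
Defined.

Lemma pt_base_point : pt base_point = cvec 0 1.
Proof. by []. Qed.

(** Gram-Schmidt gives a unitary matrix whose adjoint has q as its first column; a phase on another
    column then makes the determinant 1. *)
Lemma base_transitive (q : @S7 R) : exists s, tau s base_point = q.
Proof.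
(* All rows of [A] are equal: [schmidt] returns a unitary matrix even for dependent rows, and only
   its row 0 matters here. *)
pose v := (toC (pt q))^t*; pose A : 'M[R[i]]_4 := \matrix_(k < 4) v.
have uB : schmidt A \is unitarymx by exact: schmidt_unitarymx.
set B := schmidt A in uB.
have vE : row 0 A = v by rewrite rowK.
have := row_schmidt_sub A 0; rewrite (big_pred1 0) => [|k]; last first.
  by rewrite leqn0.
rewrite genmxE vE => /sub_rVP[c vc].
have BB : (row 0 B *m (row 0 B)^t*) 0 0 = 1.
  by have /row_unitarymxP/(_ 0 0) := uB; rewrite dotmxE eqxx.
have c0 : 0 <= c.
  have := form1_row_schmidt A 0; rewrite vE vc dotmxE -scalemxAl mxE.
  by rewrite -/B BB mulr1.
have vv : (v *m v^t*) 0 0 = c ^+ 2.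
  rewrite {1}vc -scalemxAl mxE; congr (_ * _).
  by rewrite vc linearZ /= map_mxZ -scalemxAr mxE BB mulr1; exact: geC0_conj.
(* Row 0 of [A] is c times row 0 of [B] with c nonnegative, and c^2 = |q|^2 = 1. *)
have c1 : c = 1.
  apply/eqP; rewrite -(sqrp_eq1 c0) -vv eq_complex.
  have : 0 <= (v *m v^t*) 0 0 by rewrite vv exprn_ge0.
  rewrite lecE => /andP[/eqP -> _]; rewrite eqxx andbT.
  by rewrite {2}/v trmxCK -innerE S7_norm.
rewrite c1 scale1r -/B in vc.
pose d := \det (B^t*).
(* The phase goes on column 1, so that column 0 remains q. *)
pose D := diag_mx (\row_(k < 4) (if k == 1 then Num.conj d else 1)).
have uBt : B^t* \is unitarymx by rewrite trmxC_unitary.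
have d1 : d * Num.conj d = 1.
  have /unitarymxP/(congr1 determinant) := uBt.
  by rewrite det_mulmx det1 -/d det_map_mx det_tr.
have uD : D \is unitarymx.
  apply: diag_mx_unitary => k; rewrite !mxE.
  case: (k == 1); last by rewrite rmorph1 mulr1.
  by rewrite -[RHS]d1 mulrC; congr (_ * _); exact: conjCK.
have dW : \det (B^t* *m D) = 1.
  rewrite det_mulmx det_diag (bigD1 1)//= big1 ?mxE ?mulr1// => k k1.
  by rewrite mxE (negbTE k1).
exists (MkSU4 (mul_unitarymx uBt uD) dW); apply: val_inj => /=.
rewrite su_act_cvec /= scale1r -[RHS]toCK; congr ofC.
have -> : toC (pt q) = col 0 (B^t*).
  rewrite -[LHS]trmxCK -/v vc; apply/matrixP => i j; rewrite !mxE.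
  by [].
rewrite !colE -mulmxA; congr (_ *m _); apply/matrixP => i j.
rewrite mul_diag_mx !mxE; case: eqP => [->|_]; by rewrite ?mulr0 ?mul1r.
Qed.

End SpecialUnitary.

Lemma eq_opp_eq0 (R : numDomainType) (x : R) : x = - x -> x = 0.
Proof. by move/eqP; rewrite -subr_eq0 opprK -mulr2n mulrn_eq0 => /eqP. Qed.

(** A real trilinear form is given by its eight values on 1 and i. The last two hypotheses move a
    factor i into the first slot, so these values depend only on the product of the arguments and H
    factors through u v w. *)
Lemma complex_trilinearE (R : rcfType) (H : R[i] -> R[i] -> R[i] -> R) :
  (forall u v w, H u v w = complex.Re u * H 1 v w + complex.Im u * H 'i%C v w) ->
  (forall u v w, H u v w = complex.Re v * H u 1 w + complex.Im v * H u 'i%C w) ->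
  (forall u v w, H u v w = complex.Re w * H u v 1 + complex.Im w * H u v 'i%C) ->
  (forall u w, H ('i%C * u) 1 w = H u 'i%C w) ->
  (forall u v, H ('i%C * u) v 1 = H u v 'i%C) ->
  forall u v w, H u v w =
    H 1 1 1 * complex.Re (u * v * w) + H 'i%C 1 1 * complex.Im (u * v * w).
Proof.
move=> El Em Er T12 T13 u v w.
have ii : 'i%C * 'i%C = - 1 :> R[i] by rewrite -expr2 sqr_i.
have N x y z : H (- x) y z = - H x y z.
  by rewrite El [in RHS]El !raddfN opprD !mulNr.
have e1i1 : H 1 'i%C 1 = H 'i%C 1 1 by rewrite -T12 mulr1.
have e11i : H 1 1 'i%C = H 'i%C 1 1 by rewrite -T13 mulr1.
have eii1 : H 'i%C 'i%C 1 = - H 1 1 1 by rewrite -T12 ii N.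
have ei1i : H 'i%C 1 'i%C = - H 1 1 1 by rewrite -T13 ii N.
have e1ii : H 1 'i%C 'i%C = - H 1 1 1 by rewrite -T12 mulr1.
have eiii : H 'i%C 'i%C 'i%C = - H 'i%C 1 1 by rewrite -T12 ii N e11i.
rewrite El (Em 1) (Em 'i%C) (Er 1 1) (Er 1 'i%C) (Er 'i%C 1) (Er 'i%C 'i%C).
rewrite e1i1 e11i eii1 ei1i e1ii eiii.
case: u => ? ?; case: v => ? ?; case: w => ? ? /=; ring.
Qed.

(** * Classification of the forms invariant under the stabilizer of the base point *)

Section Classification.
Context {R : realType}.
Variable f : C4 R -> C4 R -> C4 R -> R.
Hypothesis fPl : forall c (x x' : C4 R) y z,
  f (c *: x + x') y z = c * f x y z + f x' y z.
Hypothesis fPm : forall c x (y y' : C4 R) z,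
  f x (c *: y + y') z = c * f x y z + f x y' z.
Hypothesis fPr : forall c x y (z z' : C4 R),
  f x y (c *: z + z') = c * f x y z + f x y z'.
Local Notation p0 := (@base_point R).
Hypothesis f_inv : forall s x y z, su_act s (pt p0) = pt p0 ->
  f (su_act s x) (su_act s y) (su_act s z) = f x y z.
Hypothesis f_skew : forall x y z, inner y (pt p0) = 0 -> inner z (pt p0) = 0 ->
  f x y z = - f x z y.

(** The component of f on three complex coordinate axes. On axis 0 only imaginary multiples are
    tangent at the base point, hence the conditions on real parts below. *)
Let F a b c u v w := f (cvec a u) (cvec b v) (cvec c w).

Let fDl (x x' : C4 R) y z : f (x + x') y z = f x y z + f x' y z.
Proof. by have := fPl 1 x x' y z; rewrite scale1r mul1r. Qed.
Let fDm x (y y' : C4 R) z : f x (y + y') z = f x y z + f x y' z.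
Proof. by have := fPm 1 x y y' z; rewrite scale1r mul1r. Qed.
Let fDr x y (z z' : C4 R) : f x y (z + z') = f x y z + f x y z'.
Proof. by have := fPr 1 x y z z'; rewrite scale1r mul1r. Qed.
Let f0l y z : f 0 y z = 0.
Proof. by have /esym := fDl 0 0 y z;
  rewrite addr0 => /eqP; rewrite -subr_eq0 addrK => /eqP. Qed.
Let f0m x z : f x 0 z = 0.
Proof. by have /esym := fDm x 0 0 z;
  rewrite addr0 => /eqP; rewrite -subr_eq0 addrK => /eqP. Qed.
Let f0r x y : f x y 0 = 0.
Proof. by have /esym := fDr x y 0 0;
  rewrite addr0 => /eqP; rewrite -subr_eq0 addrK => /eqP. Qed.
Let fZl c (x y z : C4 R) : f (c *: x) y z = c * f x y z.
Proof. by have := fPl c x 0 y z; rewrite addr0 f0l addr0. Qed.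
Let fZm c (x y z : C4 R) : f x (c *: y) z = c * f x y z.
Proof. by have := fPm c x y 0 z; rewrite addr0 f0m addr0. Qed.
Let fZr c (x y z : C4 R) : f x y (c *: z) = c * f x y z.
Proof. by have := fPr c x y z 0; rewrite addr0 f0r addr0. Qed.

Let FEl a b c u v w :
  F a b c u v w = complex.Re u * F a b c 1 v w + complex.Im u * F a b c 'i%C v w.
Proof. by rewrite /F [cvec a u]cvecE fPl fZl. Qed.
Let FEm a b c u v w :
  F a b c u v w = complex.Re v * F a b c u 1 w + complex.Im v * F a b c u 'i%C w.
Proof. by rewrite /F [cvec b v]cvecE fPm fZm. Qed.
Let FEr a b c u v w :
  F a b c u v w = complex.Re w * F a b c u v 1 + complex.Im w * F a b c u v 'i%C.
Proof. by rewrite /F [cvec c w]cvecE fPr fZr. Qed.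

Let tangent_cvec (a : 'I_4) u : (a == 0 -> complex.Re u = 0) ->
  inner (cvec a u) (pt p0) = 0.
Proof.
rewrite pt_base_point inner_cvec => u0.
by case: eqP u0 => // _ ->; rewrite // mul0r mulr0 addr0.
Qed.

Let F_torus (k l : 'I_4) (e : R[i]) a b c (u v w : R[i]) :
  k != 0 -> l != 0 -> k != l -> e * Num.conj e = 1 ->
  let d m := if m == k then e else if m == l then Num.conj e else 1 in
  F a b c (d a * u) (d b * v) (d c * w) = F a b c u v w.
Proof.
move=> k0 l0 kl e1 d; have [s sE] := torus_exists kl e1.
rewrite /F -!sE; apply: f_inv.
by rewrite [su_act s _]sE eq_sym (negbTE k0) eq_sym (negbTE l0) mul1r.
Qed.

Let F_perm (g : {perm 'I_4}) a b c u v w : ~~ odd_perm g -> g 0 = 0 ->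
  F (g a) (g b) (g c) u v w = F a b c u v w.
Proof.
move=> ge g0; have [s sE] := @perm_exists R g ge.
by rewrite /F -!sE; apply: f_inv; rewrite [su_act s _]sE g0.
Qed.

Let cvecN (a : 'I_4) (u : R[i]) : cvec a (- u) = - cvec a u :> C4 R.
Proof.
by apply/matrixP => i b; rewrite [RHS]mxE !cvec_coord; case: (i == a); case: (b == 0);
  rewrite ?oppr0 // raddfN.
Qed.

Let FNl i j m x y z : F i j m (- x) y z = - F i j m x y z.
Proof. by rewrite /F cvecN -scaleN1r fZl mulN1r. Qed.
Let FNm i j m x y z : F i j m x (- y) z = - F i j m x y z.
Proof. by rewrite /F cvecN -scaleN1r fZm mulN1r. Qed.
Let FNr i j m x y z : F i j m x y (- z) = - F i j m x y z.
Proof. by rewrite /F cvecN -scaleN1r fZr mulN1r. Qed.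

(** The diagonal matrix with -1 at k and l changes the sign of F when an odd number of the three
    indices lies in {k, l}. *)
Let F_parity (k l a b c : 'I_4) u v w : k != 0 -> l != 0 -> k != l ->
  (a \in [:: k; l]) (+) (b \in [:: k; l]) (+) (c \in [:: k; l]) -> F a b c u v w = 0.
Proof.
move=> k0 l0 kl abc.
have e1 : -1 * Num.conj (-1 : R[i]) = 1 by rewrite rmorphN1 mulrNN mulr1.
have := F_torus a b c u v w k0 l0 kl e1; rewrite /= rmorphN1.
have dE m x : (if m == k then -1 else if m == l then -1 else 1) * x =
    if m \in [:: k; l] then - x else x :> R[i].
  by rewrite !inE; case: (m == k); case: (m == l); rewrite /= ?mulN1r ?mul1r.
rewrite !dE.
by move: abc; case: (a \in _); case: (b \in _); case: (c \in _) => //= _ E;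
  apply: eq_opp_eq0;
  rewrite -{1}E ?FNl ?FNm ?FNr ?opprK.
Qed.

(** The 3-cycle 1, 2, 3, written as two transpositions to make its evenness evident. *)
Let cyc : {perm 'I_4} :=
  (tperm (1%R : 'I_4) (2%R : 'I_4) * tperm (1%R : 'I_4) (3%R : 'I_4))%g.
Let cycE : [/\ cyc 0 = 0, cyc 1 = 2, cyc 2 = 3 & cyc 3 = 1].
Proof. by split; rewrite permM !permE /=; apply: val_inj. Qed.

Let F_cyc a b c u v w : F (cyc a) (cyc b) (cyc c) u v w = F a b c u v w.
Proof.
by apply: F_perm; [rewrite odd_mul_tperm odd_tperm|case: cycE].
Qed.

Let F_cyc1 (P : 'I_4 -> R) : (forall k, k != 0 -> P (cyc k) = P k) ->
  forall k, k != 0 -> P k = P 1.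
Proof.
have [_ r1 r2 r3] := cycE => H k; have [->|->|->|->] := I4P k => // _.
  by rewrite -r1 H.
by rewrite -r2 H// -r1 H.
Qed.

Let F_skew a b c u v w : (b == 0 -> complex.Re v = 0) -> (c == 0 -> complex.Re w = 0) ->
  F a b c u v w = - F a c b u w v.
Proof. by move=> v0 w0; apply: f_skew; exact: tangent_cvec. Qed.

(** Skewness in v and w leaves a multiple of the area form on the real plane of axis k; [cyc] makes
    the factor independent of k. *)
Let F_0kk k u v w : k != 0 -> complex.Re u = 0 ->
  F 0 k k u v w = complex.Im u * F 0 1 1 'i%C 1 'i%C *
    (complex.Re v * complex.Im w - complex.Im v * complex.Re w).
Proof.
move=> k0 u0; have sk x y : F 0 k k 'i%C x y = - F 0 k k 'i%C y x.
  by apply: F_skew; rewrite (negbTE k0).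
have F0 x : F 0 k k 'i%C x x = 0.
  exact: eq_opp_eq0 (sk x x).
have <- : F 0 k k 'i%C 1 'i%C = F 0 1 1 'i%C 1 'i%C.
  refine (F_cyc1 (P := fun k => F 0 k k 'i%C 1 'i%C) _ k0) => m _.
  by have [r0 _ _ _] := cycE; rewrite -{1}r0 F_cyc.
rewrite FEl u0 mul0r add0r FEm (FEr _ _ _ _ 1) (FEr _ _ _ _ 'i%C) !F0 (sk 'i%C).
by ring.
Qed.

Let conj_i : 'i%C * Num.conj ('i%C : R[i]) = 1.
Proof.
by apply/eqP; rewrite eq_complex /=; apply/andP; split; apply/eqP; ring.
Qed.

(** Multiplying axis k by i and a third axis by -i shows invariance under (u, w) -> (i u, i w), so
    only the real and imaginary parts of conj(u) w can occur. *)
Let F_k0k k u v w : k != 0 -> complex.Re v = 0 ->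
  F k 0 k u v w = complex.Im v *
    (F 1 0 1 1 'i%C 1 * (complex.Re u * complex.Re w + complex.Im u * complex.Im w)
     + F 1 0 1 1 'i%C 'i%C *
       (complex.Re u * complex.Im w - complex.Im u * complex.Re w)).
Proof.
move=> k0 v0.
have [l [l0 kl]] : exists l : 'I_4, l != 0 /\ k != l.
  by have [->|k1] := eqVneq k 1; [exists 2|exists 1].
have Ei x y : F k 0 k ('i%C * x) 'i%C ('i%C * y) = F k 0 k x 'i%C y.
  have := F_torus k 0 k x 'i%C y k0 l0 kl conj_i.
  by rewrite /= eqxx eq_sym (negbTE k0) eq_sym (negbTE l0) mul1r.
have Ek w' : F k 0 k 1 'i%C w' = F 1 0 1 1 'i%C w'.
  refine (F_cyc1 (P := fun k => F k 0 k 1 'i%C w') _ k0) => m _.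
  by have [r0 _ _ _] := cycE; rewrite -{1}r0 F_cyc.
have E11 := Ei 1 1; have E1i := Ei 1 'i%C.
have ii : 'i%C * 'i%C = - 1 :> R[i].
  by apply/eqP; rewrite eq_complex /=; apply/andP; split; apply/eqP; ring.
rewrite ii !mulr1 in E11 E1i.
have E2 : F k 0 k 'i%C 'i%C 1 = - F k 0 k 1 'i%C 'i%C.
  by apply: oppr_inj; rewrite opprK; exact: etrans (esym (FNr _ _ _ _ _ _)) E1i.
rewrite FEm v0 mul0r add0r FEl (FEr _ _ _ 1) (FEr _ _ _ 'i%C) E11 E2 !Ek.
by move: (F 1 0 1 1 'i%C 1) (F 1 0 1 1 'i%C 'i%C) => A B; ring.
Qed.

(** The torus elements i on axis 1 and -i on axis 2 or 3 supply the two exchange hypotheses of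
    [complex_trilinearE]. *)
Let F_123 u v w :
  F 1 2 3 u v w = F 1 2 3 1 1 1 * complex.Re (u * v * w)
    + F 1 2 3 'i%C 1 1 * complex.Im (u * v * w).
Proof.
have ci : Num.conj ('i%C : R[i]) = - 'i%C.
  by apply/eqP; rewrite eq_complex /=; apply/andP; split; apply/eqP; ring.
apply: (complex_trilinearE (FEl 1 2 3) (FEm 1 2 3) (FEr 1 2 3)) => x y.
- have := @F_torus 1 2 'i%C 1 2 3 x 'i%C y isT isT isT conj_i.
  by rewrite /= ci mulNr -expr2 sqr_i opprK mul1r.
- have := @F_torus 1 3 'i%C 1 2 3 x y 'i%C isT isT isT conj_i.
  by rewrite /= ci mulNr -expr2 sqr_i opprK mul1r.
Qed.

(** The full table of components in terms of five constants; [hermitian] comes from [F_k0k] and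
    [vol] from [F_123]. *)
Let form_on_axes (a b c : nat) (u v w : R[i]) : R :=
  let hermitian u v :=
    F 1 0 1 1 'i%C 1 * (complex.Re u * complex.Re v + complex.Im u * complex.Im v)
    + F 1 0 1 1 'i%C 'i%C *
      (complex.Re u * complex.Im v - complex.Im u * complex.Re v) in
  let vol := F 1 2 3 1 1 1 * complex.Re (u * v * w)
    + F 1 2 3 'i%C 1 1 * complex.Im (u * v * w) in
  match a, b, c with
  | 0%N, S j, S k => if j == k then
      complex.Im u * F 0 1 1 'i%C 1 'i%C *
        (complex.Re v * complex.Im w - complex.Im v * complex.Re w) else 0
  | S i, 0%N, S k => if i == k then complex.Im v * hermitian u w else 0
  | S i, S j, 0%N => if i == j then - (complex.Im w * hermitian u v) else 0
  | 1%N, 2%N, 3%N | 2%N, 3%N, 1%N | 3%N, 1%N, 2%N => vol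
  | 1%N, 3%N, 2%N | 3%N, 2%N, 1%N | 2%N, 1%N, 3%N => - vol
  | _, _, _ => 0
  end.

Let F_kk0 k u v w : k != 0 -> complex.Re w = 0 ->
  F k k 0 u v w = - (complex.Im w *
    (F 1 0 1 1 'i%C 1 * (complex.Re u * complex.Re v + complex.Im u * complex.Im v)
     + F 1 0 1 1 'i%C 'i%C *
       (complex.Re u * complex.Im v - complex.Im u * complex.Re v))).
Proof.
move=> k0 w0; rewrite -(F_k0k _ _ k0 w0).
by apply: F_skew => // /eqP k1; rewrite k1 in k0.
Qed.

Let F_000 u v w : complex.Re v = 0 -> complex.Re w = 0 -> F 0 0 0 u v w = 0.
Proof.
move=> v0 w0; rewrite FEm v0 mul0r add0r FEr w0 mul0r add0r.
by rewrite (eq_opp_eq0 (@F_skew 0 0 0 u 'i%C 'i%C _ _))// !mulr0.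
Qed.

(** Skewness in the last two arguments reduces an odd permutation of (1, 2, 3) to an even one. *)
Let odd_vol a b c u v w : b != 0 -> c != 0 ->
  F a c b u w v = F 1 2 3 1 1 1 * complex.Re (u * w * v)
    + F 1 2 3 'i%C 1 1 * complex.Im (u * w * v) ->
  F a b c u v w = - (F 1 2 3 1 1 1 * complex.Re (u * v * w)
    + F 1 2 3 'i%C 1 1 * complex.Im (u * v * w)).
Proof.
move=> b0 c0 E; rewrite (mulrAC u v w) -E.
by apply: F_skew; [rewrite (negbTE b0)|rewrite (negbTE c0)].
Qed.

Let FE (a b c : 'I_4) u v w :
  (a == 0 -> complex.Re u = 0) -> (b == 0 -> complex.Re v = 0) ->
  (c == 0 -> complex.Re w = 0) -> F a b c u v w = form_on_axes a b c u v w.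
Proof.
have [c0 c1 c2 c3] := cycE.
have F231 x y z : F 2 3 1 x y z = F 1 2 3 x y z.
  by have := F_cyc 1 2 3 x y z; rewrite c1 c2 c3.
have F312 x y z : F 3 1 2 x y z = F 1 2 3 x y z.
  by have := F_cyc 2 3 1 x y z; rewrite c1 c2 c3 F231.
(* The three parity tests eliminate every triple in which 1, 2, 3 do not all occur with the same
   parity. Left are 000, one 0 with a repeated k, and the permutations of 1, 2, 3. *)
have [->|->|->|->] := I4P a; have [->|->|->|->] := I4P b;
have [->|->|->|->] := I4P c => u0 v0 w0; rewrite /form_on_axes /=;
first [ by apply: (@F_parity 1 2)
      | by apply: (@F_parity 1 3)
      | by apply: (@F_parity 2 3)
      | by apply: F_0kk (u0 isT)
      | by apply: F_k0k (v0 isT)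
      | by apply: F_kk0 (w0 isT)
      | exact: F_123
      | exact: etrans (F231 _ _ _) (F_123 _ _ _)
      | exact: etrans (F312 _ _ _) (F_123 _ _ _)
      | by apply: odd_vol => //; exact: F_123
      | by apply: odd_vol => //; exact: etrans (F231 _ _ _) (F_123 _ _ _)
      | by apply: odd_vol => //; exact: etrans (F312 _ _ _) (F_123 _ _ _)
      | exact: F_000 (v0 isT) (w0 isT) ].
Qed.

Let f_sum x y z : f x y z =
  \sum_a \sum_b \sum_c F a b c (toC x a 0) (toC y b 0) (toC z c 0).
Proof.
rewrite {1}(C4_sum_cvec x).
rewrite (big_morph (fun x => f x y z) (fun x x' => fDl x x' y z) (f0l y z)).
apply: eq_bigr => a _; rewrite {1}(C4_sum_cvec y).
rewrite (big_morph (fun y => f _ y z) (fun y y' => fDm _ y y' z) (f0m _ z)).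
apply: eq_bigr => b _; rewrite {1}(C4_sum_cvec z).
exact: (big_morph (fun z => f _ _ z) (fun z z' => fDr _ _ z z') (f0r _ _)).
Qed.

Lemma invariant_form_classification : exists k1 k2 k3 k4 k5, forall x y z,
  inner x (pt p0) = 0 -> inner y (pt p0) = 0 -> inner z (pt p0) = 0 ->
  f x y z = invform k1 k2 k3 k4 k5 (pt p0) x y z.
Proof.
(* At the base point [et x] in [invform] is minus the imaginary part of the coordinate 0 of x. This
   gives the sign of the third constant; that of the first comes from the order of x and z in its
   Hermitian factor. *)
exists (- F 1 0 1 1 'i%C 'i%C), (F 1 0 1 1 'i%C 1), (- F 0 1 1 'i%C 1 'i%C).
exists (F 1 2 3 1 1 1), (F 1 2 3 'i%C 1 1) => x y z.
have t0 u : inner u (pt p0) = 0 -> u 0 0 = 0.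
  by rewrite pt_base_point inner_coord !cvec_coord /= !mulr0 !addr0 mulr1.
move=> /t0 x0 /t0 y0 /t0 z0.
have tC (u : C4 R) (a : 'I_4) : u 0 0 = 0 -> a == 0 -> complex.Re (toC u a 0) = 0.
  by move=> u0 /eqP ->; rewrite mxE.
rewrite pt_base_point f_sum.
under eq_bigr => a _ do under eq_bigr => b _ do under eq_bigr => c _ do
  rewrite (FE (tC x a x0) (tC y b y0) (tC z c z0)).
rewrite /form_on_axes; move: (F 1 0 1 1 'i%C 'i%C) (F 1 0 1 1 'i%C 1).
move: (F 0 1 1 'i%C 1 'i%C) (F 1 2 3 1 1 1) (F 1 2 3 'i%C 1 1) => k3 k4 k5 k1 k2.
rewrite !sum4E /=.
have toCE (u : C4 R) a : toC u a 0 = u a 0 +i* u a 1 by rewrite mxE.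
rewrite !toCE /= /invform !inner_lmulqi.
rewrite (inner_coord x) (inner_coord x).
rewrite cdet_coord /det4 /= !inord4.
rewrite !cvec_coord /= x0 y0 z0.
ring.
Qed.

End Classification.

(** * Invariant connections *)

Section InvariantConnections.
Context {R : realType}.
Local Notation S7 := (@S7 R).
Local Notation vfield := (@vfield R).

Section Model.
Variable nablag : connection R.
Hypothesis nablag_LC : levi_civita nablag.

(** The Sasakian identity for the covariant derivative of psi_1: multiplication by i commutes with
    the flat derivative, so only the normal corrections contribute. *)
Lemma inner_cov_psi (X Y : vfield) p z : inner z (pt p) = 0 ->
  inner (cov_psi nablag qi X Y p) z =
    inner (X p) (Y p) * eta qi p z - eta qi p (Y p) * inner (X p) z.
Proof.
move=> zp; have zE : z = proj_field z p by rewrite /= tanproj_tangent.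
have Xp := vf_tangent X p.
have sY := vf_smooth Y.
have siY a b : smooth (fun q => lmulq qi (Y q) a b) by exact: smooth_lin.
have seta : smooth (fun q => -1 * eta qi q (Y q)).
  apply: smoothM; first exact: smooth_cst.
  by apply: smooth_inner smooth_pt.
have E1 : inner (nablag X (vpsi qi Y) p) z =
    inner (lmulq qi (vdirder Y p (X p))) z - eta qi p (Y p) * inner (X p) z.
  rewrite {1}zE (levi_civitaE nablag_LC) -zE.
  have -> : vfval (vpsi qi Y) =
      (fun q => lmulq qi (Y q) + (-1 * eta qi q (Y q)) *: pt q).
    by apply/funext => q; rewrite /= /psi mulN1r scaleNr.
  rewrite (vdirderD siY _ Xp); last exact: smoothZmx seta smooth_pt.
  rewrite (vdirderZ seta smooth_pt Xp) (vdirder_lin (lmulq qi) sY Xp) (vdirder_pt Xp).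
  by rewrite !innerDl !innerZl (innerC (pt p)) zp mulr0 add0r mulN1r mulNr.
have E2 : inner (psi qi p (nablag X Y p)) z =
    inner (lmulq qi (vdirder Y p (X p))) z - inner (X p) (Y p) * eta qi p z.
  have pz : inner (psi qi p z) (pt p) = 0.
    by rewrite /psi innerBl innerZl S7_norm mulr1 subrr.
  have pzE : psi qi p z = proj_field (psi qi p z) p by rewrite /= tanproj_tangent.
  (* Skewness of psi moves it onto z, where [levi_civitaE] can be used. *)
  have -> : inner (psi qi p (nablag X Y p)) z = - inner (nablag X Y p) (psi qi p z).
    rewrite /psi innerBl innerBr !innerZl innerZr (innerC (pt p)) zp vf_tangent.
    by rewrite !mulr0 !subr0 inner_lmulqi_skew innerC.
  rewrite {1}pzE (levi_civitaE nablag_LC) -pzE /psi innerBr innerZr.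
  (* Differentiating the tangency relation between Y and p gives the normal part of the flat
     derivative. *)
  have DYp : inner (vdirder Y p (X p)) (pt p) = - inner (X p) (Y p).
    have := dirder_inner sY smooth_pt Xp; rewrite (vdirder_pt Xp).
    have -> : (fun q => inner (Y q) (pt q)) = (fun=> 0).
      by apply/funext => q; exact: vf_tangent.
    by rewrite dirder_cst (innerC (X p)) => /esym/eqP; rewrite addr_eq0 => /eqP.
  by rewrite DYp inner_lmulqi_skew (innerC (vdirder Y p (X p)) (lmulq qi z)); ring.
rewrite /cov_psi innerBl E1 E2; ring.
Qed.

(** The common shape of both formulas of the theorem, with coefficients in the order of
    [invform]. *)
Definition model_term (r1 r2 r3 r4 r5 : R) (X Y : vfield) (p : S7) : C4 R :=
  r1 *: (Phi qi p (X p) (Y p) *: xi qi p + eta qi p (Y p) *: psi qi p (X p))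
  + r2 *: cov_psi nablag qi X Y p
  + r3 *: (eta qi p (X p) *: psi qi p (Y p))
  + r4 *: Theta p (X p) (Y p)
  + r5 *: tTheta p (X p) (Y p).

Lemma inner_psi_pt q p (x : C4 R) : inner (psi q p x) (pt p) = 0.
Proof. by rewrite /psi innerBl innerZl S7_norm mulr1 subrr. Qed.

Let inner_comb r1 r2 r3 r4 r5 (a b c : R) (u v w x y t z : C4 R) :
  inner (r1 *: (a *: u + b *: v) + r2 *: w + r3 *: (c *: x) + r4 *: y + r5 *: t) z
  = r1 * (a * inner u z + b * inner v z) + r2 * inner w z + r3 * (c * inner x z)
    + r4 * inner y z + r5 * inner t z.
Proof. by rewrite !(innerDl, innerZl). Qed.

Lemma model_term_tangent r1 r2 r3 r4 r5 X Y p :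
  inner (model_term r1 r2 r3 r4 r5 X Y p) (pt p) = 0.
Proof.
have ipp : inner (lmulq qi (pt p)) (pt p) = 0.
  by apply: eq_opp_eq0; exact: inner_lmulqi_skew.
rewrite /model_term inner_comb !inner_psi_pt Theta_tangent tTheta_tangent.
rewrite /cov_psi innerBl (vf_tangent (nablag X (vpsi qi Y))) inner_psi_pt.
by rewrite /xi innerNl ipp; ring.
Qed.

(** The sign of r5 arises because [tTheta] pairs with z to minus the imaginary part of the
    determinant. *)
Lemma inner_model_term r1 r2 r3 r4 r5 X Y p z : inner z (pt p) = 0 ->
  inner (model_term r1 r2 r3 r4 r5 X Y p) z =
  invform r1 r2 r3 r4 (- r5) (pt p) (X p) (Y p) z.
Proof.
move=> zp; have [Xp Yp] := (vf_tangent X p, vf_tangent Y p).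
have psiE x : inner (psi qi p x) z = inner (lmulq qi x) z.
  by rewrite /psi innerBl innerZl (innerC (pt p)) zp mulr0 subr0.
rewrite /model_term inner_comb !psiE inner_cov_psi// ThetaE// tThetaE//.
rewrite Omega_cdet// Omega_psi_cdet// Phi_tangent// /xi innerNl.
rewrite (inner_lmulqi_skew (pt p) z) (inner_lmulqi_skew (X p) z) /invform /eta.
ring.
Qed.

(** Both the difference of the connections and [model_term] are tangent, so pairing with tangent
    vectors loses nothing. *)
Lemma model_termP (nabla : connection R) r1 r2 r3 r4 r5 X Y p :
  nabla X Y p = nablag X Y p + model_term r1 r2 r3 r4 r5 X Y p <->
  forall z, inner z (pt p) = 0 -> difftensor nablag nabla p (X p) (Y p) z =
    invform r1 r2 r3 r4 (- r5) (pt p) (X p) (Y p) z.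
Proof.
split=> [E z zp|E].
  rewrite -difftensorE /conn_diff E (addrC (nablag X Y p)) addrK.
  exact: inner_model_term.
apply/eqP; rewrite addrC -subr_eq; apply/eqP.
apply: (@inner_inj_tangent _ p) => [||z zp].
- exact: conn_diff_tangent.
- exact: model_term_tangent.
- by rewrite inner_model_term// -E// -difftensorE.
Qed.

End Model.

End InvariantConnections.

(** * Skewness conditions on the coefficients *)

Lemma lmulqi_cvec (R : realType) a (u : R[i]) : lmulq qi (cvec a u) = cvec a ('i%C * u).
Proof. by rewrite -[LHS]toCK toC_lmulqi /cvec ofCK scalerA. Qed.

Lemma cdet_swap12 (R : realType) (p x y z : C4 R) : cdet p y x z = - cdet p x y z.
Proof. by rewrite !cdetE /det4 /=; ring. Qed.

Lemma cdet_swap13 (R : realType) (p x y z : C4 R) : cdet p z y x = - cdet p x y z.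
Proof. by rewrite !cdetE /det4 /=; ring. Qed.

(** For k2 = 0 and k3 = -k1 the first three terms add up to a multiple of the wedge of eta_1 and
    Phi_1, and the determinant is alternating. *)
Lemma invform_swap (R : realType) r a b (p x y z : C4 R) :
  invform r 0 (- r) a b p y x z = - invform r 0 (- r) a b p x y z.
Proof.
rewrite /invform cdet_swap12 !raddfN /= (inner_lmulqi_skew y x) (inner_lmulqi_skew z y).
by rewrite (inner_lmulqi_skew z x); ring.
Qed.

(** The obstruction to skewness in the outer arguments: the determinants cancel, which isolates k2
    and k1 + k3. *)
Lemma invform_sym13 (R : realType) k1 k2 k3 k4 k5 (p x y z : C4 R) :
  let et x := inner (lmulq qi x) p in
  invform k1 k2 k3 k4 k5 p y x z + invform k1 k2 k3 k4 k5 p z x y =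
  (k1 + k3) * (inner (lmulq qi x) y * et z + inner (lmulq qi x) z * et y)
  + k2 * (inner x y * et z + inner x z * et y - (inner y z * et x) *+ 2).
Proof.
rewrite /invform (cdet_swap13 p y x z) !raddfN /= (inner_lmulqi_skew z y).
by rewrite (innerC z y) (innerC y x) (innerC z x); ring.
Qed.

(* The skewness is tested on (v, xi, v) and (xi, v, i v), with v orthogonal to xi. *)
Lemma invform_skew_coef (R : realType) k1 k2 k3 k4 k5 :
  let p := pt (@base_point R) in
  (forall x y z, inner x p = 0 -> inner y p = 0 -> inner z p = 0 ->
    invform k1 k2 k3 k4 k5 p y x z = - invform k1 k2 k3 k4 k5 p z x y) ->
  k2 = 0 /\ k3 = - k1.
Proof.
rewrite pt_base_point => /= H.
have inner_lmulqi_cvec a b (u v : R[i]) : inner (lmulq qi (cvec a u)) (cvec b v) =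
    if a == b then complex.Re u * complex.Im v - complex.Im u * complex.Re v else 0.
  rewrite lmulqi_cvec inner_cvec; case: (a == b) => //.
  by case: u v => ? ? [? ?] /=; ring.
have np : inner (cvec 0 'i%C) (cvec 0 1) = 0 :> R by rewrite inner_cvec /=; ring.
have vp u : inner (cvec 1 u) (cvec 0 1) = 0 :> R by rewrite inner_cvec.
have vv : inner (cvec 1 1) (cvec 1 1) = 1 :> R by rewrite inner_cvec /=; ring.
have vw : inner (cvec 1 1) (cvec 1 'i%C) = 0 :> R by rewrite inner_cvec /=; ring.
have vn : inner (cvec 1 1) (cvec 0 'i%C) = 0 :> R by rewrite inner_cvec.
have nv : inner (cvec 0 'i%C) (cvec 1 1) = 0 :> R by rewrite inner_cvec.
have inp : inner (lmulq qi (cvec 0 'i%C)) (cvec 0 1) = - 1 :> R.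
  by rewrite inner_lmulqi_cvec /=; ring.
have ivp u : inner (lmulq qi (cvec 1 u)) (cvec 0 1) = 0 :> R.
  by rewrite inner_lmulqi_cvec.
have inv : inner (lmulq qi (cvec 0 'i%C)) (cvec 1 1) = 0 :> R.
  by rewrite inner_lmulqi_cvec.
have ivn : inner (lmulq qi (cvec 1 1)) (cvec 0 'i%C) = 0 :> R.
  by rewrite inner_lmulqi_cvec.
have ivw : inner (lmulq qi (cvec 1 1)) (cvec 1 'i%C) = 1 :> R.
  by rewrite inner_lmulqi_cvec /=; ring.
move: (vp 1) (vp 'i%C) (ivp 1) (ivp 'i%C) H np vv vw vn nv inp inv ivn ivw.
move: (cvec 0 1) (cvec 0 'i%C) (cvec 1 1) (cvec 1 'i%C) => p n v w.
move=> vp0 wp ivp0 iwp H np vv vw vn nv inp inv ivn ivw.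
have sym x y z xp yp zp := etrans (esym (invform_sym13 k1 k2 k3 k4 k5 p x y z))
   (etrans (congr1 (fun t => t + _) (H x y z xp yp zp)) (addNr _)).
(* Here n = i p is minus xi_1 and w = i v. The first test yields 2 k2 = 0, the second k1 + k3 =
   0. *)
have := sym n v v np vp0 vp0; rewrite /= inp ivp0 inv vv nv => E1.
have := sym v n w vp0 np wp; rewrite /= inp iwp ivp0 ivn ivw vn vw => E2.
split.
  by apply: eq_opp_eq0; apply/eqP; rewrite -subr_eq0 opprK -E1; apply/eqP; ring.
by apply/eqP; rewrite -addr_eq0 -oppr_eq0 -E2; apply/eqP; ring.
Qed.

(** * Transport from the base point and comparison of coefficients *)

Theorem theorem5p13 (R : realType) (nablag nabla : connection R)
    (nablag_LC : levi_civita nablag)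
    (nabla_inv : SU4_invariant nabla)
    (nabla_metric : is_metric nabla) :
  (exists (q1 q2 : R[i]) (t : R), forall (X Y : @vfield R) (p : @S7 R),
     nabla X Y p =
       nablag X Y p
       + (complex.Re q1 - 1) *:
           (Phi qi p (X p) (Y p) *: xi qi p + eta qi p (Y p) *: psi qi p (X p))
       + complex.Im q1 *: cov_psi nablag qi X Y p
       + (t + 1 / 3) *: (eta qi p (X p) *: psi qi p (Y p))
       - complex.Re q2 *: Theta p (X p) (Y p)
       + complex.Im q2 *: tTheta p (X p) (Y p))
  /\
  (totally_skew_torsion nabla <->
   exists (r : R) (q : R[i]), forall (X Y : @vfield R) (p : @S7 R),
     nabla X Y p =
       nablag X Y p
       + r *: (Phi qi p (X p) (Y p) *: xi qi p
               - eta qi p (X p) *: psi qi p (Y p)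
               + eta qi p (Y p) *: psi qi p (X p))
       + complex.Re q *: Theta p (X p) (Y p)
       + complex.Im q *: tTheta p (X p) (Y p)).
Proof.
have [k1 [k2 [k3 [k4 [k5 kP]]]]] : exists k1 k2 k3 k4 k5, forall p x y z,
    inner x (pt p) = 0 -> inner y (pt p) = 0 -> inner z (pt p) = 0 ->
    difftensor nablag nabla p x y z = invform k1 k2 k3 k4 k5 (pt p) x y z.
  have [|||s x y z sp|x y z yp zp|k1 [k2 [k3 [k4 [k5 kP]]]]] :=
      @invariant_form_classification R (difftensor nablag nabla (base_point)).
  - exact: difftensorPl.
  - exact: difftensorPm.
  - exact: difftensorPr.
  - rewrite -[RHS](difftensor_inv nablag_LC base_point s _ _ _ nabla_inv).
    by congr difftensor; apply: val_inj.
  - exact: difftensor_skew.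
  exists k1, k2, k3, k4, k5 => p x y z xp yp zp.
  (* Both sides are SU(4)-invariant, so transitivity carries the constants found at the base point
     to every p. *)
  have [s sE] := base_transitive p; rewrite -sE in xp yp zp *.
  pose act := su_act_inv s.
  have tan u : inner u (pt (tau s base_point)) = 0 ->
      inner (su_act (su_inv s) u) (pt base_point) = 0.
    by move=> up; rewrite -(su_act_inner s) act.
  rewrite -(act x) -(act y) -(act z).
  rewrite (difftensor_inv nablag_LC _ _ _ _ _ nabla_inv) invform_act.
  by apply: kP; exact: tan.
(* As [nablag] is torsion free, the torsion of [nabla] is the difference tensor antisymmetrized in
   its first two arguments. *)
have torE (X Y Z : @vfield R) p : inner (torsion nabla X Y p) (Z p) =
    difftensor nablag nabla p (X p) (Y p) (Z p)
    - difftensor nablag nabla p (Y p) (X p) (Z p).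
  have [_ /(_ X Y p) ntor] := nablag_LC.
  have sub (V : zmodType) (a b c d l : V) :
      c - d - l = 0 -> a - b - l = (a - c) - (b - d).
    move/eqP; rewrite subr_eq0 => /eqP <-.
    by rewrite !opprB addrACA [RHS]addrACA (addrC (- b)).
  have E := sub _ (nabla X Y p) (nabla Y X p) _ _ _ ntor.
  by rewrite -!difftensorE -innerBl /torsion E.
split.
  (* The shifts by 1 and 1/3 undo those in the formula; k5 enters negated because of the sign of
     [tTheta]. *)
  exists ((k1 + 1) +i* k2), ((- k4) +i* (- k5)), (k3 - 1 / 3) => X Y p /=.
  have -> : nabla X Y p = nablag X Y p + model_term nablag k1 k2 k3 k4 (- k5) X Y p.
    by apply/(model_termP nablag_LC) => z zp; rewrite opprK kP// vf_tangent.
  have [-> ->] : k1 + 1 - 1 = k1 /\ k3 - 1 / 3 + 1 / 3 = k3 by rewrite addrK subrK.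
  rewrite /model_term.
  move: (cov_psi _ _ _ _ _) (Theta _ _ _) (tTheta _ _ _) (eta _ _ _ *: psi _ _ (Y p)).
  by move: (_ + eta _ _ _ *: _) => A B C D E; rewrite !scaleNr opprK !addrA.
(* The second formula is [model_term] with r2 = 0 and r3 = -r1. *)
have skewE r (q : R[i]) X Y p :
  nablag X Y p
       + r *: (Phi qi p (X p) (Y p) *: xi qi p
               - eta qi p (X p) *: psi qi p (Y p)
               + eta qi p (Y p) *: psi qi p (X p))
       + complex.Re q *: Theta p (X p) (Y p)
       + complex.Im q *: tTheta p (X p) (Y p) =
  nablag X Y p + model_term nablag r 0 (- r) (complex.Re q) (complex.Im q) X Y p.
  rewrite /model_term.
  move: (cov_psi _ _ _ _ _) (Theta _ _ _) (tTheta _ _ _) (eta _ _ _ *: psi _ _ (Y p)).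
  move: (Phi _ _ _ _ *: _) (eta _ _ _ *: _) (nablag X Y p) => P E N C T T' F.
  by rewrite scale0r addr0 scaleNr -scalerBr !addrA (addrAC P E).
split.
  case=> _ _ _ _ wskew.
  (* Write f for the difference tensor. Skew torsion gives f(x,z,y) - f(z,x,y) = f(y,x,z) -
     f(x,y,z), and metricity cancels f(x,z,y) against -f(x,y,z). *)
  have W (X Y Z : @vfield R) p : difftensor nablag nabla p (Y p) (X p) (Z p) =
      - difftensor nablag nabla p (Z p) (X p) (Y p).
    have := etrans (esym (torE X Z Y p))
      (etrans (wskew X Y Z p) (congr1 -%R (torE X Y Z p))).
    rewrite (difftensor_skew nablag_LC _ nabla_metric (vf_tangent Z p)
      (vf_tangent Y p)).
    move: (difftensor _ _ _ (X p) (Y p) (Z p)) (difftensor _ _ _ (Z p) (X p) (Y p)).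
    move: (difftensor _ _ _ _ _ _) => C A B E.
    by apply: (addrI (- A)); rewrite E opprB addrC.
  have [k20 k3E] : k2 = 0 /\ k3 = - k1.
    apply: (@invform_skew_coef R k1 k2 k3 k4 k5); move: base_point => p x y z xp yp zp.
    have ext u : inner u (pt p) = 0 -> exists U : @vfield R, U p = u.
      by move=> up; exists (proj_field u); exact: tanproj_tangent.
    rewrite -(kP _ _ _ _ yp xp zp) -(kP _ _ _ _ zp xp yp).
    have [[X <-] [Y <-] [Z <-]] := And3 (ext x xp) (ext y yp) (ext z zp).
    exact: W.
  exists k1, (k4 +i* (- k5)) => X Y p; rewrite skewE.
  apply/(model_termP nablag_LC) => z zp /=.
  by rewrite kP ?vf_tangent// k20 k3E opprK.
move=> [r [q rqE]].
have D (X Y : @vfield R) p z : inner z (pt p) = 0 ->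
    difftensor nablag nabla p (X p) (Y p) z =
    invform r 0 (- r) (complex.Re q) (- complex.Im q) (pt p) (X p) (Y p) z.
  by move: z; apply/(model_termP nablag_LC); rewrite rqE skewE.
(* Here the difference tensor is skew in its first two arguments by [invform_swap], so
   antisymmetrizing doubles it. *)
have wE (X Y Z : @vfield R) p : inner (torsion nabla X Y p) (Z p) =
    difftensor nablag nabla p (X p) (Y p) (Z p) *+ 2.
  rewrite torE (D Y X p _ (vf_tangent Z p)) invform_swap -D ?vf_tangent//.
  by rewrite opprK mulr2n.
have dZ p c x y z : difftensor nablag nabla p (c *: x) y z =
    c * difftensor nablag nabla p x y z.
  have -> : c *: x = (c - 1) *: x + x by rewrite scalerBl scale1r subrK.
  by rewrite difftensorPl; ring.
have dD p x x' y z : difftensor nablag nabla p (x + x') y z =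
    difftensor nablag nabla p x y z + difftensor nablag nabla p x' y z.
  by rewrite -[x]scale1r difftensorPl mul1r scale1r.
(* Smoothness holds since [nabla X Y] and [nablag X Y] are smooth fields; the last skewness is
   metricity. *)
split=> [X Y Z|X X' Y Z p|f X Y Z p|X Y Z p|X Y Z p].
- under eq_fun do rewrite wE -difftensorE /conn_diff mulr2n innerBl.
  have sN (g h : @vfield R) : smooth (fun p => - inner (g p) (h p)).
    under eq_fun do rewrite -mulN1r; apply: smoothM; first exact: smooth_cst.
    by apply: smooth_inner; exact: vf_smooth.
  have sD : smooth (fun p => inner (nabla X Y p) (Z p) - inner (nablag X Y p) (Z p)).
    exact: (smoothD (smooth_inner (vf_smooth (nabla X Y)) (vf_smooth Z))
      (sN (nablag X Y) Z)).
  exact: (smoothD sD sD).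
- apply: etrans (wE _ _ _ _) (etrans _ (esym (congr2 +%R (wE X Y Z p) (wE X' Y Z p)))).
  by rewrite -mulrnDl; congr (_ *+ _); exact: dD.
- apply: etrans (wE _ _ _ _) (etrans _ (esym (congr1 ( *%R (f p)) (wE X Y Z p)))).
  by rewrite mulrnAr; congr (_ *+ _); exact: dZ.
- apply: etrans (wE Y X Z p) (etrans _ (esym (congr1 -%R (wE X Y Z p)))).
  rewrite -mulNrn; congr (_ *+ _).
  apply: etrans (D Y X p _ (vf_tangent Z p)) (etrans (invform_swap _ _ _ _ _ _ _) _).
  by congr (- _); exact: esym (D X Y p _ (vf_tangent Z p)).
- apply: etrans (wE X Z Y p) (etrans _ (esym (congr1 -%R (wE X Y Z p)))).
  rewrite -mulNrn; congr (_ *+ _).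
  by apply: (difftensor_skew nablag_LC _ nabla_metric); exact: vf_tangent.
Qed.
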